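(* (ZF, without the Axiom of Choice.) For each infinite cardinal $\kappa\in On$ the following hold: (1) $\kappa^+\to(\kappa)^1_\kappa$; (2) $|\mathbb T_{<\kappa}|\le\kappa$; (3) $Regressive(\kappa^+,\kappa)$; (4) ${[\kappa^+]}^{<\omega}\to\Delta(\kappa)$; (5) $\kappa^+\to(\kappa,\omega+1)$.
   Context: The base theory is ZF. Cardinals are initial ordinals; $\kappa^+$ is the least cardinal in $On$ greater than $\kappa$. $\mu\to(\lambda)^1_\kappa$ means: for every $f:\mu\to\kappa$ there is a set $H\subset\mu$ of cardinality $\lambda$ on which $f$ is constant. For infinite cardinals $\kappa,\lambda\in On$, the notation $|\mathbb T_{<\kappa}|\le\lambda$ means: for each tree $T\subset On^{<\omega}$ (a set of finite sequences of ordinals closed under initial segments), if $|\{\alpha\in On: s^\frown\alpha\in T\}|<\kappa$ for every $s\in T$, then $|T|\le\lambda$. For cardinals $\mu,\lambda\in On$, $Regressive(\mu,\lambda)$ means: for each regressive function $f:\mu\to\mu$ (i.e. $f(\alpha)<\alpha$ for all $0<\alpha<\mu$) there is $\alpha<\mu$ such that $|f^{-1}\{\alpha\}|\ge\lambda$. For infinite cardinals $\mu,\lambda$, ${[\mu]}^{<\omega}\to\Delta(\lambda)$ means: every family $\mathcal A$ of finite sets of ordinals with $|\mathcal A|=\mu$ contains a $\Delta$-system $\mathcal B\subset\mathcal A$ with $|\mathcal B|=\lambda$ (a $\Delta$-system is a family for which there is a set $D$, the kernel, such that $A\cap B=D$ for all distinct members $A,B$). $\mu\to(\lambda,\omega+1)$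 means: for every $f:[\mu]^2\to 2$ there is either a set $H\subset\mu$ of order type $\lambda$ with $f$ constantly $0$ on $[H]^2$, or a set $H\subset\mu$ of order type $\omega+1$ with $f$ constantly $1$ on $[H]^2$. *)

(* Defs.v *)
(* ZF is rendered semantically: a theorem of ZF is a sentence true in every
   first-order structure satisfying the ZF axioms (Goedel completeness). *)

Record structure := Structure {
  dom :> Type;
  mem : dom -> dom -> Prop
}.
Arguments mem {_} _ _.

Declare Scope zf_scope.
Notation "x ∈ y" := (mem x y) (at level 70, no associativity) : zf_scope.
Open Scope zf_scope.

(* First-order formulas of the language of set theory, with de Bruijn indices:
   under a quantifier, index 0 is the bound variable. *)
Inductive formula : Set :=
| Fmem (i j : nat)
| Feq (i j : nat)
| Fbot
| Fimp (p q : formula)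
| Fand (p q : formula)
| For (p q : formula)
| Fall (p : formula)
| Fex (p : formula).

Definition scons {A : Type} (x : A) (e : nat -> A) (n : nat) : A :=
  match n with O => x | S m => e m end.

Fixpoint sat {M : structure} (e : nat -> M) (p : formula) : Prop :=
  match p with
  | Fmem i j => e i ∈ e j
  | Feq i j => e i = e j
  | Fbot => False
  | Fimp p q => sat e p -> sat e q
  | Fand p q => sat e p /\ sat e q
  | For p q => sat e p \/ sat e q
  | Fall p => forall x : M, sat (scons x e) p
  | Fex p => exists x : M, sat (scons x e) p
  end.

Definition subset {M : structure} (x y : M) : Prop := forall z : M, z ∈ x -> z ∈ y.
Definition empty {M : structure} (x : M) : Prop := forall z : M, ~ z ∈ x.
Definition nonempty {M : structure} (x : M) : Prop := exists z : M, z ∈ x.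

(* u = {a, b} *)
Definition is_upair {M : structure} (u a b : M) : Prop :=
  forall z : M, z ∈ u <-> z = a \/ z = b.

(* y = x ∪ {x} *)
Definition is_succ {M : structure} (x y : M) : Prop :=
  forall z : M, z ∈ y <-> z ∈ x \/ z = x.

Definition extensionality (M : structure) : Prop :=
  forall x y : M, (forall z : M, z ∈ x <-> z ∈ y) -> x = y.
Definition foundation (M : structure) : Prop :=
  forall x : M, nonempty x -> exists y : M, y ∈ x /\ forall z : M, z ∈ x -> ~ z ∈ y.
Definition pairing (M : structure) : Prop :=
  forall a b : M, exists u : M, is_upair u a b.
Definition union (M : structure) : Prop :=
  forall a : M, exists u : M, forall z : M, z ∈ u <-> exists y : M, y ∈ a /\ z ∈ y.
Definition powerset (M : structure) : Prop :=
  forall a : M, exists u : M, forall z : M, z ∈ u <-> subset z a.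
Definition infinity (M : structure) : Prop :=
  exists w : M, (exists z : M, empty z /\ z ∈ w) /\
    forall x : M, x ∈ w -> exists y : M, is_succ x y /\ y ∈ w.

(* The two schemas range over first-order formulas with parameters and not over
   arbitrary Rocq predicates: otherwise a choice axiom of the metatheory would
   make every model satisfy the Axiom of Choice. *)
Definition separation (M : structure) : Prop :=
  forall (p : formula) (e : nat -> M) (a : M),
    exists b : M, forall x : M, x ∈ b <-> x ∈ a /\ sat (scons x e) p.
Definition replacement (M : structure) : Prop :=
  forall (p : formula) (e : nat -> M) (a : M),
    (forall x : M, x ∈ a -> forall y y' : M,
       sat (scons y (scons x e)) p -> sat (scons y' (scons x e)) p -> y = y') ->
    exists b : M, forall y : M,
      y ∈ b <-> exists x : M, x ∈ a /\ sat (scons y (scons x e)) p.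

Record ZF (M : structure) : Prop := {
  zf_extensionality : extensionality M;
  zf_foundation : foundation M;
  zf_pairing : pairing M;
  zf_union : union M;
  zf_powerset : powerset M;
  zf_infinity : infinity M;
  zf_separation : separation M;
  zf_replacement : replacement M
}.

(* From here on all notions are internal to M: quantifiers range over M only,
   so that each definition is a first-order formula of set theory. *)

(* Kuratowski: p = {{x}, {x, y}} *)
Definition is_pair {M : structure} (p x y : M) : Prop :=
  forall z : M, z ∈ p <-> is_upair z x x \/ is_upair z x y.

(* <x, y> ∈ f; when f is a function, f(x) = y *)
Definition maps {M : structure} (f x y : M) : Prop :=
  exists p : M, is_pair p x y /\ p ∈ f.

Definition function_on {M : structure} (f a : M) : Prop :=
  (forall p : M, p ∈ f -> exists x y : M, x ∈ a /\ is_pair p x y) /\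
  (forall x : M, x ∈ a -> exists! y : M, maps f x y).

Definition function {M : structure} (f a b : M) : Prop :=
  function_on f a /\ forall x y : M, maps f x y -> y ∈ b.

Definition injection {M : structure} (f a b : M) : Prop :=
  function f a b /\ forall x x' y : M, maps f x y -> maps f x' y -> x = x'.

Definition bijection {M : structure} (f a b : M) : Prop :=
  injection f a b /\ forall y : M, y ∈ b -> exists x : M, maps f x y.

(* |a| = |b|, |a| <= |b|, |a| < |b| *)
Definition card_eq {M : structure} (a b : M) : Prop := exists f : M, bijection f a b.
Definition card_le {M : structure} (a b : M) : Prop := exists f : M, injection f a b.
Definition card_lt {M : structure} (a b : M) : Prop := card_le a b /\ ~ card_eq a b.

Definition transitive {M : structure} (x : M) : Prop :=
  forall y : M, y ∈ x -> subset y x.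

Definition well_ordered_by_mem {M : structure} (x : M) : Prop :=
  (forall y : M, y ∈ x -> ~ y ∈ y) /\
  (forall u v w : M, u ∈ x -> v ∈ x -> w ∈ x -> u ∈ v -> v ∈ w -> u ∈ w) /\
  (forall u v : M, u ∈ x -> v ∈ x -> u ∈ v \/ u = v \/ v ∈ u) /\
  (forall s : M, subset s x -> nonempty s ->
     exists m : M, m ∈ s /\ forall u : M, u ∈ s -> m = u \/ m ∈ u).

Definition ordinal {M : structure} (x : M) : Prop :=
  transitive x /\ well_ordered_by_mem x.

Definition natural {M : structure} (n : M) : Prop :=
  ordinal n /\
  forall m : M, m ∈ n \/ m = n -> empty m \/ exists k : M, is_succ k m.

Definition is_omega {M : structure} (w : M) : Prop :=
  forall n : M, n ∈ w <-> natural n.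

Definition finite {M : structure} (a : M) : Prop :=
  exists n : M, natural n /\ card_eq a n.

Definition cardinal {M : structure} (k : M) : Prop :=
  ordinal k /\ forall a : M, a ∈ k -> ~ card_eq a k.

Definition infinite_cardinal {M : structure} (k : M) : Prop :=
  cardinal k /\ ~ finite k.

(* m = k^+, the least cardinal greater than k *)
Definition is_cardinal_succ {M : structure} (k m : M) : Prop :=
  cardinal m /\ k ∈ m /\
  forall n : M, cardinal n -> k ∈ n -> m = n \/ m ∈ n.

(* The set h of ordinals has order type l. *)
Definition order_type {M : structure} (h l : M) : Prop :=
  exists f : M, bijection f l h /\
    forall a b x y : M, maps f a x -> maps f b y -> (a ∈ b <-> x ∈ y).

(* mu -> (l)^1_k *)
Definition arrow1 {M : structure} (mu l k : M) : Prop :=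
  forall f : M, function f mu k ->
    exists h : M, subset h mu /\ card_eq h l /\
      exists c : M, forall x : M, x ∈ h -> maps f x c.

(* s is a sequence of ordinals of length n, n a natural number *)
Definition ordinal_seq {M : structure} (s n : M) : Prop :=
  natural n /\ function_on s n /\ forall i x : M, maps s i x -> ordinal x.

Definition in_On_lt_omega {M : structure} (s : M) : Prop :=
  exists n : M, ordinal_seq s n.

(* For finite sequences (functions on natural numbers), the initial segments of
   s are the sequences included in s. *)
Definition tree {M : structure} (T : M) : Prop :=
  (forall s : M, s ∈ T -> in_On_lt_omega s) /\
  (forall s t : M, s ∈ T -> in_On_lt_omega t -> subset t s -> t ∈ T).

(* t = s^a, the sequence s followed by a *)
Definition is_snoc {M : structure} (s a t : M) : Prop :=
  exists n : M, ordinal_seq s n /\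
    forall p : M, p ∈ t <-> p ∈ s \/ is_pair p n a.

(* x = {a ∈ On : s^a ∈ T} *)
Definition is_children {M : structure} (T s x : M) : Prop :=
  forall a : M, a ∈ x <-> ordinal a /\ exists t : M, is_snoc s a t /\ t ∈ T.

(* |T_{<k}| <= l *)
Definition tree_bound {M : structure} (k l : M) : Prop :=
  forall T : M, tree T ->
    (forall s : M, s ∈ T -> exists x : M, is_children T s x /\ card_lt x k) ->
    card_le T l.

(* Regressive(mu, l) *)
Definition regressive_property {M : structure} (mu l : M) : Prop :=
  forall f : M, function f mu mu ->
    (forall a b : M, a ∈ mu -> nonempty a -> maps f a b -> b ∈ a) ->
    exists a : M, a ∈ mu /\
      exists r : M, (forall x : M, x ∈ r <-> maps f x a) /\ card_le l r.

Definition delta_system {M : structure} (B : M) : Prop :=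
  exists d : M, forall a b : M, a ∈ B -> b ∈ B -> a <> b ->
    forall x : M, x ∈ d <-> x ∈ a /\ x ∈ b.

(* [mu]^{<omega} -> Delta(l) *)
Definition arrow_delta {M : structure} (mu l : M) : Prop :=
  forall A : M,
    (forall a : M, a ∈ A -> finite a /\ forall x : M, x ∈ a -> ordinal x) ->
    card_eq A mu ->
    exists B : M, subset B A /\ delta_system B /\ card_eq B l.

(* q = [x]^2, the set of two-element subsets of x *)
Definition is_pairs {M : structure} (x q : M) : Prop :=
  forall p : M, p ∈ q <-> exists a b : M, a ∈ x /\ b ∈ x /\ a <> b /\ is_upair p a b.

(* f is constantly c on [h]^2 *)
Definition homogeneous {M : structure} (f h c : M) : Prop :=
  forall q : M, is_pairs h q -> forall p : M, p ∈ q -> maps f p c.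

(* mu -> (l, omega + 1); here zero, one, two, w, w1 are the ordinals
   0, 1, 2, omega, omega + 1. *)
Definition arrow_omega1 {M : structure} (mu l : M) : Prop :=
  forall zero one two w w1 q : M,
    empty zero -> is_succ zero one -> is_succ one two ->
    is_omega w -> is_succ w w1 -> is_pairs mu q ->
    forall f : M, function f q two ->
      (exists h : M, subset h mu /\ order_type h l /\ homogeneous f h zero) \/
      (exists h : M, subset h mu /\ order_type h w1 /\ homogeneous f h one).

(* Main.v *)
(* Everything rests on coding trees.  As [|k * k| = k], there is an
   injective code [k * k -> k \ {0}], so if the children of every node of a tree
   are listed, uniformly and without choice, by ordinals below [k], the nodes can
   be coded injectively by elements of [k].  Sets of ordinals are listed by their
   order type, which is below [k] once the set has no subset of order type [k].
   Except in (2), a counterexample would inject [k^+] into [k].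

   (1) [a] is coded by [f a] and its index in its fibre.  (2) is the principle
   itself.  (3) The children of [b] are the nonzero points of its fibre.
   (4) Nodes are finite sets [d]; the children of [d] are the sets [d ∪ {z}] for
   [z] in a member of a greedily chosen maximal Delta-system [B d] with kernel
   [d].  Every member of the family lies in some [B d]: otherwise a node inside
   it could be extended forever.  (5) Nodes are finite [1]-homogeneous sets [d];
   their children are the [d ∪ {x}] for [x] in a greedy maximal
   [0]-homogeneous set [H d] of points compatible with [d].  Below each [a] a
   greedy branch [K a] leads to a node with [a ∈ H (K a)] unless it is infinite,
   and then it yields a [1]-homogeneous set of type [omega + 1]. *)
From Stdlib Require Import ssreflect Classical ClassicalEpsilon PeanoNat.
Require Import Defs.
Set Bullet Behavior "None".

(** * Definability with parameters *)

(** A contradiction needs a single injection of [k^+] into [k] given by a formula. Hence every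
    enumeration must be canonical: sets of ordinals are listed by their own order, and maximal sets
    come from recursion along the ordinals instead of Zorn's lemma. A node may acquire many codes,
    as in (4), where a finite set can be reached by adding its points in different orders; it is
    enough that a code determines its node, since least codes can then be picked.

    Separation and replacement hold in [M] only for formulas with parameters, so each relation to
    which they are applied must be shown definable. [defn] and [tdef] express this for Rocq
    predicates and operations, and the tactic [definable] discharges it. The epsilon operator of the
    metatheory only names sets that are already unique by extensionality, so it brings no choice
    into [M]. *)

Definition up (r : nat -> nat) (n : nat) : nat :=
  match n with O => O | S m => S (r m) end.

Fixpoint ren (r : nat -> nat) (p : formula) : formula :=
  match p with
  | Fmem i j => Fmem (r i) (r j)
  | Feq i j => Feq (r i) (r j)
  | Fbot => Fbot
  | Fimp p q => Fimp (ren r p) (ren r q)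
  | Fand p q => Fand (ren r p) (ren r q)
  | For p q => For (ren r p) (ren r q)
  | Fall p => Fall (ren (up r) p)
  | Fex p => Fex (ren (up r) p)
  end.

Section Definability.
Context {M : structure}.
Implicit Types (e : nat -> M) (P Q : (nat -> M) -> Prop).

Lemma sat_ren p r e e' :
  (forall i, e (r i) = e' i) -> sat e (ren r p) <-> sat e' p.
Proof.
elim: p r e e' => [i j|i j||p IHp q IHq|p IHp q IHq|p IHp q IHq|p IHp|p IHp] r e e' E /=.
- by rewrite !E.
- by rewrite !E.
- by [].
- by rewrite (IHp _ _ _ E) (IHq _ _ _ E).
- by rewrite (IHp _ _ _ E) (IHq _ _ _ E).
- by rewrite (IHp _ _ _ E) (IHq _ _ _ E).
- have H x : sat (scons x e) (ren (up r) p) <-> sat (scons x e') p.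
    by apply: IHp; case.
  by split=> h x; apply/H.
- have H x : sat (scons x e) (ren (up r) p) <-> sat (scons x e') p.
    by apply: IHp; case.
  by split=> -[x /H hx]; exists x.
Qed.

(* [t] says, for each free variable of the formula, whether it stands for a
   variable of the environment or for a parameter. *)
Definition interp (t : nat -> nat + M) e (i : nat) : M :=
  match t i with inl j => e j | inr c => c end.

Definition defn P : Prop :=
  exists p t, forall e, sat (interp t e) p <-> P e.

Definition tdef (u : (nat -> M) -> M) : Prop :=
  defn (fun e => e 0 = u (fun n => e (S n))).

Lemma defn_ext P Q : (forall e, P e <-> Q e) -> defn Q -> defn P.
Proof. by move=> E [p [t H]]; exists p, t => e; rewrite H E. Qed.

(** Classically such a proposition is true or false, so a closed formula without quantifiers
    represents it, whatever [A] says. *)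
Lemma defn_const (A : Prop) : defn (fun _ => A).
Proof.
case: (classic A) => a; first by exists (Fimp Fbot Fbot), (fun _ => inl 0) => e /=; tauto.
by exists Fbot, (fun _ => inl 0).
Qed.

(** Two formulas come with two parameter assignments. Moving the variables of one to even indices
    and those of the other to odd indices lets one assignment serve both. *)
Lemma defn_merge P Q : defn P -> defn Q ->
  exists p q t, (forall e, sat (interp t e) p <-> P e) /\
                (forall e, sat (interp t e) q <-> Q e).
Proof.
move=> [p [t H]] [q [u K]].
exists (ren (fun i => 2 * i) p), (ren (fun i => S (2 * i)) q),
  (fun i => if Nat.even i then t (Nat.div2 i) else u (Nat.div2 i)).
split=> e; rewrite -?H -?K; apply: sat_ren => i; rewrite /interp.
- by rewrite Nat.even_even Nat.div2_double.
- by rewrite Nat.even_succ Nat.odd_even Nat.div2_succ_double.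
Qed.

Lemma defn_and P Q : defn P -> defn Q -> defn (fun e => P e /\ Q e).
Proof.
move=> HP HQ; have [p [q [t [Hp Hq]]]] := defn_merge _ _ HP HQ.
by exists (Fand p q), t => e /=; rewrite Hp Hq.
Qed.

Lemma defn_or P Q : defn P -> defn Q -> defn (fun e => P e \/ Q e).
Proof.
move=> HP HQ; have [p [q [t [Hp Hq]]]] := defn_merge _ _ HP HQ.
by exists (For p q), t => e /=; rewrite Hp Hq.
Qed.

Lemma defn_imp P Q : defn P -> defn Q -> defn (fun e => P e -> Q e).
Proof.
move=> HP HQ; have [p [q [t [Hp Hq]]]] := defn_merge _ _ HP HQ.
by exists (Fimp p q), t => e /=; rewrite Hp Hq.
Qed.

Lemma defn_not P : defn P -> defn (fun e => ~ P e).
Proof. by move=> HP; apply: defn_imp HP (defn_const False). Qed.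

Lemma defn_iff P Q : defn P -> defn Q -> defn (fun e => P e <-> Q e).
Proof. by move=> HP HQ; apply: defn_and; apply: defn_imp. Qed.

(** A quantifier binds index 0 of the formula, whereas several indices may stand for variable 0 of
    the environment. All of these are renamed to 0 and every other index is shifted past it. *)
Lemma interp_under P : defn P ->
  exists p t, forall e x, sat (scons x (interp t e)) p <-> P (scons x e).
Proof.
move=> [p [t H]].
exists (ren (fun i => match t i with inl 0 => 0 | _ => S i end) p),
  (fun i => match t i with inl (S j) => inl j | inl 0 => inl 0 | inr c => inr c end).
move=> e x; rewrite -H; apply: sat_ren => i; rewrite /interp.
by case E: (t i) => [[|j]|c] //=; rewrite E.
Qed.

Lemma defn_ex (P : (nat -> M) -> M -> Prop) :
  defn (fun e => P (fun n => e (S n)) (e 0)) -> defn (fun e => exists x, P e x).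
Proof.
move=> /interp_under [p [t H]]; exists (Fex p), t => e /=.
by split=> -[x h]; exists x; apply/(H e x).
Qed.

Lemma defn_all (P : (nat -> M) -> M -> Prop) :
  defn (fun e => P (fun n => e (S n)) (e 0)) -> defn (fun e => forall x, P e x).
Proof.
move=> /interp_under [p [t H]]; exists (Fall p), t => e /=.
by split=> h x; [move/(H e x): (h x) | apply/(H e x); apply: (h x)].
Qed.

Lemma defn_ren (r : nat -> nat) P : defn P -> defn (fun e => P (fun n => e (r n))).
Proof.
move=> [p [t H]].
exists (ren (fun i => i) p),
  (fun i => match t i with inl j => inl (r j) | inr c => inr c end) => e.
by rewrite -H; apply: sat_ren => i; rewrite /interp; case: (t i).
Qed.

Lemma defn_atom (op : M -> M -> Prop) (f : nat -> nat -> formula) i j :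
  (forall e i j, sat e (f i j) <-> op (e i) (e j)) -> defn (fun e => op (e i) (e j)).
Proof. by move=> H; exists (f i j), (fun i => inl i) => e; rewrite H. Qed.

Lemma tdef_var i : tdef (fun e => e i).
Proof. exact: (defn_atom eq Feq 0 (S i)). Qed.

Lemma tdef_const (c : M) : tdef (fun _ => c).
Proof.
by exists (Feq 0 1), (fun i => match i with 0 => inl 0 | _ => inr c end).
Qed.

Lemma tdef_ren (r : nat -> nat) u : tdef u -> tdef (fun e => u (fun n => e (r n))).
Proof. by move=> H; apply: (defn_ren (up r)) H. Qed.

(** The language has no function symbols: a defined term is eliminated by quantifying over its
    value, described by its graph. *)
Lemma defn_subst1 (P : M -> Prop) u :
  defn (fun e => P (e 0)) -> tdef u -> defn (fun e => P (u e)).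
Proof.
move=> H1 H2.
apply: (defn_ext _ (fun e => exists y, y = u e /\ P y)).
  by move=> e; split=> [h|[y [-> h]]] //; exists (u e).
apply: defn_ex; exact: defn_and.
Qed.

Lemma defn_subst2 (P : M -> M -> Prop) u v :
  defn (fun e => P (e 0) (e 1)) -> tdef u -> tdef v -> defn (fun e => P (u e) (v e)).
Proof.
move=> H1 H2 H3.
apply: (defn_ext _ (fun e => exists y, y = v e /\ P (u e) y)).
  by move=> e; split=> [h|[y [-> h]]] //; exists (v e).
apply/defn_ex/defn_and => //.
apply: (defn_ext _ (fun e => exists y, y = u (fun n => e (S n)) /\ P y (e 0))).
  by move=> e; split=> [h|[y [-> h]]] //; eexists; split.
apply/defn_ex/defn_and => //; exact: (tdef_ren S).
Qed.

Lemma defn_subst3 (P : M -> M -> M -> Prop) u v w :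
  defn (fun e => P (e 0) (e 1) (e 2)) -> tdef u -> tdef v -> tdef w ->
  defn (fun e => P (u e) (v e) (w e)).
Proof.
move=> H1 H2 H3 H4.
apply: (defn_ext _ (fun e => exists y, y = w e /\ P (u e) (v e) y)).
  by move=> e; split=> [h|[y [-> h]]] //; exists (w e).
apply/defn_ex/defn_and => //.
apply: (defn_ext _ (fun e =>
  exists y, y = v (fun n => e (S n)) /\ P (u (fun n => e (S n))) y (e 0))).
  by move=> e; split=> [h|[y [-> h]]] //; eexists; split.
apply/defn_ex/defn_and; first exact: (tdef_ren S).
apply: (defn_ext _ (fun e => exists y, y = u (fun n => e (S (S n))) /\ P y (e 0) (e 1))).
  by move=> e; split=> [h|[y [-> h]]] //; eexists; split.
apply/defn_ex/defn_and => //; exact: (tdef_ren (fun n => S (S n))).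
Qed.

Lemma defn_mem u v : tdef u -> tdef v -> defn (fun e => u e ∈ v e).
Proof. by apply: defn_subst2; apply: (defn_atom mem Fmem). Qed.

Lemma defn_eq u v : tdef u -> tdef v -> defn (fun e => u e = v e).
Proof. by apply: (defn_subst2 eq); apply: (defn_atom eq Feq). Qed.

Lemma tdef_fun1 (F : M -> M) u :
  defn (fun e => e 0 = F (e 1)) -> tdef u -> tdef (fun e => F (u e)).
Proof.
move=> H1 H2; apply: (defn_subst2 (fun y x => y = F x)) => //; first exact: (tdef_var 0).
exact: (tdef_ren S).
Qed.

Lemma tdef_fun2 (F : M -> M -> M) u v :
  defn (fun e => e 0 = F (e 1) (e 2)) -> tdef u -> tdef v ->
  tdef (fun e => F (u e) (v e)).
Proof.
move=> H1 H2 H3; apply: (defn_subst3 (fun y x z => y = F x z)) => //; first exact: (tdef_var 0).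
- exact: (tdef_ren S).
- exact: (tdef_ren S).
Qed.

Lemma interp_under2 (P : (nat -> M) -> Prop) : defn P ->
  exists (p : formula) (t : nat -> nat + M), forall e x y,
    sat (scons y (scons x (interp t e))) p <-> P (scons y (scons x e)).
Proof.
move=> [p [t H]].
exists (ren (fun i => match t i with inl 0 => 0 | inl 1 => 1 | _ => S (S i) end) p),
  (fun i => match t i with inl (S (S j)) => inl j | inl _ => inl 0 | inr c => inr c end).
move=> e x y; rewrite -H; apply: sat_ren => i; rewrite /interp.
by case E: (t i) => [[|[|j]]|c] //=; rewrite E.
Qed.

End Definability.

(** * Automation for definability goals *)

Ltac definable_hyp :=
  match goal with
  | H : defn (fun e => ?R (e 0)) |- defn (fun e => ?R (@?u e)) =>
      apply (defn_subst1 R u H)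
  | H : defn (fun e => ?R (e 0) (e 1)) |- defn (fun e => ?R (@?u e) (@?v e)) =>
      apply (defn_subst2 R u v H)
  | H : defn (fun e => ?R (e 0) (e 1) (e 2))
    |- defn (fun e => ?R (@?u e) (@?v e) (@?w e)) =>
      apply (defn_subst3 R u v w H)
  | H : defn (fun e => e 0 = ?F (e 1)) |- tdef (fun e => ?F (@?u e)) =>
      apply (tdef_fun1 F u H)
  | H : defn (fun e => e 0 = ?F (e 1) (e 2)) |- tdef (fun e => ?F (@?u e) (@?v e)) =>
      apply (tdef_fun2 F u v H)
  end.
(* Slots filled in by [::=] as further notions are shown to be definable. *)
Ltac definable_hint1 := fail.
Ltac definable_hint2 := fail.
Ltac definable_hint3 := fail.
Ltac definable_hint4 := fail.
Ltac definable_hint5 := fail.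
Ltac definable_hint :=
  first [ definable_hyp | definable_hint1 | definable_hint2 | definable_hint3
        | definable_hint4 | definable_hint5 ].

Ltac definable_step :=
  lazymatch goal with
  | |- defn (fun _ => ?A) => apply (defn_const A)
  | |- defn (fun e => @?A e /\ @?B e) => apply (defn_and A B)
  | |- defn (fun e => @?A e \/ @?B e) => apply (defn_or A B)
  | |- defn (fun e => @?A e <-> @?B e) => apply (defn_iff A B)
  | |- defn (fun e => ~ @?A e) => apply (defn_not A)
  | |- defn (fun e => exists! x, @?A e x) => unfold unique
  | |- defn (fun e => exists x, @?A e x) => apply (defn_ex A); cbv beta
  | |- defn (fun e => @?u e = @?v e) => apply (defn_eq u v)
  | |- defn (fun e => mem (@?u e) (@?v e)) => apply (defn_mem u v)
  | |- defn (fun e => forall x : dom _, @?A e x) => apply (defn_all A); cbv beta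
  | |- defn (fun e => @?A e -> @?B e) => apply (defn_imp A B)
  | |- tdef (fun e => e ?i) => apply (tdef_var i)
  | |- tdef (fun _ => ?c) => apply (tdef_const c)
  | |- _ => definable_hint
  end.
Ltac definable := cbv beta; repeat (definable_step; cbv beta).

Section ZFTheory.
Variables (M : structure) (HZF : ZF M).
Implicit Types (a b c d f g h i j k l m n p q r s t x y z : M).

(** * Elementary set theory *)

Lemma inhM : inhabited M.
Proof. by have [w _] := zf_infinity _ HZF; exists. Qed.

Lemma ext x y : (forall z, z ∈ x <-> z ∈ y) -> x = y.
Proof. exact: (zf_extensionality _ HZF). Qed.

Lemma sep (P : M -> Prop) a : defn (fun e => P (e 0)) ->
  exists b, forall x, x ∈ b <-> x ∈ a /\ P x.
Proof.
move=> /interp_under [p [t H]]; have [c] := inhM.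
have [b Hb] := zf_separation _ HZF p (interp t (fun _ => c)) a.
by exists b => x; rewrite Hb (H (fun _ => c) x).
Qed.

Lemma repl (R : M -> M -> Prop) a : defn (fun e => R (e 0) (e 1)) ->
  (forall x y y', x ∈ a -> R x y -> R x y' -> y = y') ->
  exists b, forall y, y ∈ b <-> exists x, x ∈ a /\ R x y.
Proof.
move=> H U; have [c] := inhM.
(* The replacement schema keeps the value at index 0 and the argument at index 1, the reverse of
   [R]. *)
have K : defn (fun e => R (e 1) (e 0)).
  exact: (defn_ren (fun n : nat => match n with 0 => 1 | 1 => 0 | n => n end) _ H).
have [p [t L]] := interp_under2 _ K; set e := fun _ : nat => c.
have [x xa y y'|b Hb] := zf_replacement _ HZF p (interp t e) a.
  move=> /(L e) h /(L e) h'; exact: (U x).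
exists b => y; rewrite Hb.
by split=> -[x [xa h]]; exists x; split=> //; apply/(L e).
Qed.

(* Junk value: the empty set when [P] is a proper class. *)
Definition setof (P : M -> Prop) : M :=
  epsilon inhM (fun y => (forall z, z ∈ y <-> P z) \/
                         (~ (exists b, forall z, z ∈ b <-> P z)) /\ empty y).

Lemma in_setof (P : M -> Prop) :
  (exists b, forall z, z ∈ b <-> P z) -> forall z, z ∈ setof P <-> P z.
Proof.
move=> H; rewrite /setof; set Q := fun y => _.
have /(epsilon_spec inhM Q) [//|[]//] : exists y, Q y.
by case: H => b Hb; exists b; left.
Qed.

Lemma ex_empty : exists x, empty x.
Proof. by have [w [[z [H _]] _]] := zf_infinity _ HZF; exists z. Qed.

(** By extensionality the condition behind the epsilon term has exactly one solution. The condition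
    is first-order when [P] is, which makes [setof] a definable operation. *)
Lemma setof_spec (P : M -> Prop) y :
  y = setof P <-> (forall z, z ∈ y <-> P z) \/
                  (~ (exists b, forall z, z ∈ b <-> P z)) /\ empty y.
Proof.
have [[b Hb]|N] := classic (exists b, forall z, z ∈ b <-> P z).
  have S := in_setof P (ex_intro _ b Hb).
  split=> [->|[h|[[]]]]; first by left.
  - by apply: ext => z; rewrite h S.
  - by exists b.
rewrite /setof; set Q := fun y => _.
have [|h|[_ h]] := epsilon_spec inhM Q; first by have [x hx] := ex_empty; exists x; right.
  by case: N; eexists; apply: h.
split=> [->|[h'|[_ h']]]; first by right.
- by case: N; eexists; apply: h'.
- by apply: ext => z; split=> hz; [case: (h' z)|case: (h z)].
Qed.

Lemma tdef_setof (P : (nat -> M) -> M -> Prop) :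
  defn (fun e => P (fun n : nat => e (S n)) (e 0)) -> tdef (fun e => setof (P e)).
Proof.
move=> H; rewrite /tdef; apply: defn_ext.
  by move=> e; apply: setof_spec.
have H1 : defn (fun e => P (fun n : nat => e (S (S n))) (e 0)).
  exact: (defn_ren (fun n : nat => match n with 0 => 0 | S n => S (S n) end) _ H).
have H2 : defn (fun e => P (fun n : nat => e (S (S (S n)))) (e 0)).
  exact: (defn_ren (fun n : nat => match n with 0 => 0 | S n => S (S (S n)) end) _ H).
apply: defn_or.
  apply: (defn_all (fun e z => z ∈ e 0 <-> P (fun n : nat => e (S n)) z)).
  by apply: defn_iff => //; apply: defn_mem; apply: tdef_var.
apply: defn_and.
  apply: defn_not.
  apply: (defn_ex (fun e b => forall z, z ∈ b <-> P (fun n : nat => e (S n)) z)).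
  apply: (defn_all (fun e z => z ∈ e 0 <-> P (fun n : nat => e (S (S n))) z)).
  by apply: defn_iff => //; apply: defn_mem; apply: tdef_var.
rewrite /empty; definable.
Qed.

Ltac definable_hint1 ::=
  lazymatch goal with
  | |- tdef (fun e => setof (@?P e)) => apply (tdef_setof P)
  end.

Definition emp : M := setof (fun z => False).
Definition upr a b : M := setof (fun z => z = a \/ z = b).
Definition pr a b : M := upr (upr a a) (upr a b).
Definition un a : M := setof (fun z => exists y, y ∈ a /\ z ∈ y).
Definition pow a : M := setof (fun z => subset z a).
Definition inter a b : M := setof (fun z => z ∈ a /\ z ∈ b).
Definition adj a x : M := setof (fun z => z ∈ a \/ z = x).
Definition prod a b : M := setof (fun z => exists x y, x ∈ a /\ y ∈ b /\ z = pr x y).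
(** As the union of all values of [f] at [x], application is total: it is the value of a function on
    its domain and [emp] outside it. *)
Definition app f x : M := setof (fun z => exists y, pr x y ∈ f /\ z ∈ y).

Lemma in_emp z : z ∈ emp <-> False.
Proof.
rewrite in_setof //; have [x H] := ex_empty; exists x => t.
by split=> // h; case: (H t).
Qed.

Lemma in_upr a b z : z ∈ upr a b <-> z = a \/ z = b.
Proof. by rewrite in_setof //; have [u H] := zf_pairing _ HZF a b; exists u. Qed.

Lemma in_un a z : z ∈ un a <-> exists y, y ∈ a /\ z ∈ y.
Proof. by rewrite in_setof //; have [u H] := zf_union _ HZF a; exists u. Qed.

Lemma in_pow a z : z ∈ pow a <-> subset z a.
Proof. by rewrite in_setof //; have [u H] := zf_powerset _ HZF a; exists u. Qed.

Lemma in_inter a b z : z ∈ inter a b <-> z ∈ a /\ z ∈ b.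
Proof. by rewrite in_setof //; apply: (sep (fun z => z ∈ b)); definable. Qed.

Lemma in_adj a x z : z ∈ adj a x <-> z ∈ a \/ z = x.
Proof.
rewrite in_setof //; exists (un (upr a (upr x x))) => t; rewrite in_un.
split=> [[y []]|[h|->]]; first rewrite in_upr.
- by move=> [->|->]; [left|rewrite in_upr; tauto].
- by exists a; rewrite in_upr; tauto.
- by exists (upr x x); rewrite !in_upr; tauto.
Qed.

Lemma upr_eq a b c d : upr a b = upr c d -> (a = c /\ b = d) \/ (a = d /\ b = c).
Proof.
move=> E.
have H1 : a ∈ upr c d by rewrite -E in_upr; left.
have H2 : b ∈ upr c d by rewrite -E in_upr; right.
have H3 : c ∈ upr a b by rewrite E in_upr; left.
have H4 : d ∈ upr a b by rewrite E in_upr; right.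
move: H1 H2 H3 H4; rewrite !in_upr; intuition congruence.
Qed.

Lemma pr_inj a b c d : pr a b = pr c d -> a = c /\ b = d.
Proof.
by move=> /upr_eq [[/upr_eq h1 /upr_eq h2]|[/upr_eq h1 /upr_eq h2]]; intuition congruence.
Qed.

Lemma is_uprE u a b : is_upair u a b <-> u = upr a b.
Proof.
split=> [H|-> z]; last exact: in_upr.
by apply: ext => z; rewrite H in_upr.
Qed.

Lemma is_pairE p a b : is_pair p a b <-> p = pr a b.
Proof.
split=> [H|-> z]; last by rewrite !is_uprE in_upr.
by apply: ext => z; rewrite H in_upr !is_uprE.
Qed.

Lemma mapsE f x y : maps f x y <-> pr x y ∈ f.
Proof.
split=> [[p [/is_pairE -> //]]|h]; by exists (pr x y); rewrite is_pairE.
Qed.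

Lemma is_succE x y : is_succ x y <-> y = adj x x.
Proof.
split=> [H|-> z]; last exact: in_adj.
by apply: ext => z; rewrite H in_adj.
Qed.

Lemma emptyE x : empty x <-> x = emp.
Proof.
split=> [H|-> z]; last by rewrite in_emp.
by apply: ext => z; rewrite in_emp; split=> // h; case: (H z).
Qed.

Lemma nonemptyE x : nonempty x <-> x <> emp.
Proof.
split=> [[y h] E|h]; first by rewrite E in_emp in h.
apply: NNPP => N; apply: h; apply/emptyE => z hz; apply: N; by exists z.
Qed.

Lemma tdef_upr (u v : (nat -> M) -> M) : tdef u -> tdef v -> tdef (fun e => upr (u e) (v e)).
Proof. by apply: tdef_fun2; apply: (tdef_setof (fun e z => z = e 0 \/ z = e 1)); definable. Qed.

Lemma tdef_pr (u v : (nat -> M) -> M) : tdef u -> tdef v -> tdef (fun e => pr (u e) (v e)).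
Proof. by move=> hu hv; rewrite /pr; do 2! apply: tdef_upr. Qed.

Lemma tdef_un (u : (nat -> M) -> M) : tdef u -> tdef (fun e => un (u e)).
Proof.
by apply: tdef_fun1; apply: (tdef_setof (fun e z => exists y, y ∈ e 0 /\ z ∈ y)); definable.
Qed.

Lemma tdef_inter (u v : (nat -> M) -> M) : tdef u -> tdef v -> tdef (fun e => inter (u e) (v e)).
Proof. by apply: tdef_fun2; apply: (tdef_setof (fun e z => z ∈ e 0 /\ z ∈ e 1)); definable. Qed.

Lemma tdef_adj (u v : (nat -> M) -> M) : tdef u -> tdef v -> tdef (fun e => adj (u e) (v e)).
Proof. by apply: tdef_fun2; apply: (tdef_setof (fun e z => z ∈ e 0 \/ z = e 1)); definable. Qed.

Ltac definable_hint2 ::=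
  lazymatch goal with
  | |- tdef (fun e => upr (@?u e) (@?v e)) => apply (tdef_upr u v)
  | |- tdef (fun e => pr (@?u e) (@?v e)) => apply (tdef_pr u v)
  | |- tdef (fun e => un (@?u e)) => apply (tdef_un u)
  | |- tdef (fun e => inter (@?u e) (@?v e)) => apply (tdef_inter u v)
  | |- tdef (fun e => adj (@?u e) (@?v e)) => apply (tdef_adj u v)
  end.

Lemma tdef_app (u v : (nat -> M) -> M) : tdef u -> tdef v -> tdef (fun e => app (u e) (v e)).
Proof.
by apply: tdef_fun2; apply: (tdef_setof (fun e z => exists y, pr (e 1) y ∈ e 0 /\ z ∈ y)); definable.
Qed.

Lemma in_prod a b z : z ∈ prod a b <-> exists x y, x ∈ a /\ y ∈ b /\ z = pr x y.
Proof.
rewrite in_setof //.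
have [|c Hc] := sep (fun z => exists x y, x ∈ a /\ y ∈ b /\ z = pr x y)
                    (pow (pow (un (upr a b)))); first by definable.
exists c => t; rewrite Hc; split=> [[]//|h]; split=> //.
case: h => x [y [xa [yb ->]]].
have xu : x ∈ un (upr a b) by apply/in_un; exists a; rewrite in_upr; tauto.
have yu : y ∈ un (upr a b) by apply/in_un; exists b; rewrite in_upr; tauto.
by apply/in_pow => s; rewrite in_upr in_pow => -[->|->] w; rewrite in_upr => -[->|->].
Qed.

Lemma pr_in_prod a b x y : pr x y ∈ prod a b <-> x ∈ a /\ y ∈ b.
Proof.
rewrite in_prod; split=> [[x' [y' [xa [yb /pr_inj [-> ->]]]]]//|[xa yb]].
by exists x, y.
Qed.

Lemma defn_maps (u v w : (nat -> M) -> M) : tdef u -> tdef v -> tdef w ->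
  defn (fun e => maps (u e) (v e) (w e)).
Proof.
move=> hu hv hw; apply: (defn_ext _ (fun e => pr (v e) (w e) ∈ u e)).
  by move=> e; apply: mapsE.
by apply: defn_mem => //; apply: tdef_pr.
Qed.

Lemma defn_empty (u : (nat -> M) -> M) : tdef u -> defn (fun e => empty (u e)).
Proof. by apply: defn_subst1; rewrite /empty; definable. Qed.

Lemma defn_subset (u v : (nat -> M) -> M) : tdef u -> tdef v ->
  defn (fun e => subset (u e) (v e)).
Proof. by apply: defn_subst2; rewrite /subset; definable. Qed.

Lemma defn_is_pair (u v w : (nat -> M) -> M) : tdef u -> tdef v -> tdef w ->
  defn (fun e => is_pair (u e) (v e) (w e)).
Proof.
move=> hu hv hw; apply: (defn_ext _ (fun e => u e = pr (v e) (w e))).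
  by move=> e; apply: is_pairE.
by apply: defn_eq => //; apply: tdef_pr.
Qed.

Lemma defn_is_succ (u v : (nat -> M) -> M) : tdef u -> tdef v ->
  defn (fun e => is_succ (u e) (v e)).
Proof. by apply: defn_subst2; rewrite /is_succ; definable. Qed.

Lemma defn_ordinal (u : (nat -> M) -> M) : tdef u -> defn (fun e => ordinal (u e)).
Proof.
by apply: defn_subst1; rewrite /ordinal /transitive /well_ordered_by_mem /subset /nonempty; definable.
Qed.

Ltac definable_hint3 ::=
  lazymatch goal with
  | |- tdef (fun e => app (@?u e) (@?v e)) => apply (tdef_app u v)
  | |- tdef (fun e => setof (@?P e)) => apply (tdef_setof P)
  | |- defn (fun e => maps (@?u e) (@?v e) (@?w e)) => apply (defn_maps u v w)
  | |- defn (fun e => is_pair (@?u e) (@?v e) (@?w e)) => apply (defn_is_pair u v w)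
  | |- defn (fun e => is_succ (@?u e) (@?v e)) => apply (defn_is_succ u v)
  | |- defn (fun e => subset (@?u e) (@?v e)) => apply (defn_subset u v)
  | |- defn (fun e => empty (@?u e)) => apply (defn_empty u)
  | |- defn (fun e => nonempty (@?u e)) => unfold nonempty
  | |- defn (fun e => ordinal (@?u e)) => apply (defn_ordinal u)
  end.

(** * Functions and comparison of cardinalities *)

Lemma defn_function (u v w : (nat -> M) -> M) : tdef u -> tdef v -> tdef w ->
  defn (fun e => function (u e) (v e) (w e)).
Proof. by apply: defn_subst3; rewrite /function /function_on; definable. Qed.

Lemma defn_function_on (u v : (nat -> M) -> M) : tdef u -> tdef v ->
  defn (fun e => function_on (u e) (v e)).
Proof. by apply: defn_subst2; rewrite /function_on; definable. Qed.

Lemma fn_ex f a x : function_on f a -> x ∈ a -> exists y, maps f x y.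
Proof. by move=> [_ H] /H [y [h _]]; exists y. Qed.

Lemma fn_dom f a x y : function_on f a -> maps f x y -> x ∈ a.
Proof.
move=> [H _] /mapsE /H [x' [y' [h /is_pairE /pr_inj [-> _]]]] //.
Qed.

Lemma fn_uniq f a x y y' : function_on f a -> maps f x y -> maps f x y' -> y = y'.
Proof.
move=> F h h'; have xa := fn_dom _ _ _ _ F h.
by case: (proj2 F x xa) => z [_ U]; rewrite -(U _ h) -(U _ h').
Qed.

Lemma lam (R : M -> M -> Prop) a : defn (fun e => R (e 0) (e 1)) ->
  (forall x, x ∈ a -> exists y, R x y) ->
  (forall x y y', x ∈ a -> R x y -> R x y' -> y = y') ->
  exists f, function_on f a /\ forall x y, maps f x y <-> x ∈ a /\ R x y.
Proof.
move=> D E U.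
have [//|b Hb] := repl R a D.
have [|f Hf] := sep (fun p => exists x y, p = pr x y /\ R x y) (prod a b).
  by definable.
have K x y : maps f x y <-> x ∈ a /\ R x y.
  rewrite mapsE Hf pr_in_prod Hb; split.
    by move=> [[xa _] [x' [y' [/pr_inj [<- <-]]]]].
  move=> [xa h]; split; first by split=> //; exists x.
  by exists x, y.
exists f; split=> //; split.
  move=> p /Hf [/in_prod [x [y [xa [_ ->]]]] _]; exists x, y.
  by rewrite is_pairE.
move=> x xa; have [y h] := E x xa; exists y; split; first by rewrite K.
by move=> y' /K [_]; apply: U.
Qed.

Lemma card_le_intro (R : M -> M -> Prop) a b : defn (fun e => R (e 0) (e 1)) ->
  (forall x, x ∈ a -> exists y, y ∈ b /\ R x y) ->
  (forall x y y', x ∈ a -> R x y -> R x y' -> y = y') ->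
  (forall x x' y, x ∈ a -> x' ∈ a -> R x y -> R x' y -> x = x') ->
  card_le a b.
Proof.
move=> D E U I.
have [x xa|//|f [F K]] := lam R a D; first by have [y [_ h]] := E x xa; exists y.
exists f; split; first split=> //.
  move=> x y /K [xa h]; have [y' [yb h']] := E x xa.
  by rewrite (U _ _ _ xa h h').
by move=> x x' y /K [xa h] /K [xa' h']; apply: (I x x' y).
Qed.

Lemma card_eq_intro (R : M -> M -> Prop) a b : defn (fun e => R (e 0) (e 1)) ->
  (forall x, x ∈ a -> exists y, y ∈ b /\ R x y) ->
  (forall x y y', x ∈ a -> R x y -> R x y' -> y = y') ->
  (forall x x' y, x ∈ a -> x' ∈ a -> R x y -> R x' y -> x = x') ->
  (forall y, y ∈ b -> exists x, x ∈ a /\ R x y) ->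
  card_eq a b.
Proof.
move=> D E U I S.
have [x xa|//|f [F K]] := lam R a D; first by have [y [_ h]] := E x xa; exists y.
exists f; split; first split; first split=> //.
- move=> x y /K [xa h]; have [y' [yb h']] := E x xa.
  by rewrite (U _ _ _ xa h h').
- by move=> x x' y /K [xa h] /K [xa' h']; apply: (I x x' y).
- by move=> y /S [x [xa h]]; exists x; rewrite K.
Qed.

Lemma card_le_refl a : card_le a a.
Proof.
by apply: (card_le_intro eq);
  [definable|move=> x xa; exists x|move=> x y y' _ <- <-|move=> x y z _ _ -> ->].
Qed.

Lemma card_le_subset a b : subset a b -> card_le a b.
Proof.
by move=> H; apply: (card_le_intro eq);
  [definable|move=> x /H xa; exists x|move=> x y y' _ <- <-|move=> x y z _ _ -> ->].
Qed.

Lemma card_le_trans a b c : card_le a b -> card_le b c -> card_le a c.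
Proof.
move=> [f [[F Fb] Fi]] [g [[G Gb] Gi]].
apply: (card_le_intro (fun x z => exists y, maps f x y /\ maps g y z)); first by definable.
- move=> x xa; have [y h] := fn_ex _ _ _ F xa.
  have [z h'] := fn_ex _ _ _ G (Fb _ _ h).
  by exists z; split; [apply: Gb h'|exists y].
- move=> x z z' xa [y [h1 h2]] [y' [h1' h2']].
  rewrite (fn_uniq _ _ _ _ _ F h1' h1) in h2'.
  exact: (fn_uniq _ _ _ _ _ G h2 h2').
- move=> x x' z xa xa' [y [h1 h2]] [y' [h1' h2']].
  rewrite (Gi _ _ _ h2' h2) in h1'; exact: Fi h1 h1'.
Qed.

Lemma card_eq_le a b : card_eq a b -> card_le a b.
Proof. by move=> [f [H _]]; exists f. Qed.

Lemma card_eq_sym a b : card_eq a b -> card_eq b a.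
Proof.
move=> [f [[[F Fb] Fi] Fs]].
apply: (card_eq_intro (fun x y => maps f y x)); first by definable.
- by move=> y /Fs [x h]; exists x; split=> //; apply: fn_dom h.
- by move=> y x x' _; apply: Fi.
- by move=> y y' x _ _; apply: fn_uniq F.
- by move=> x xa; have [y h] := fn_ex _ _ _ F xa; exists y; split=> //; apply: Fb h.
Qed.

Lemma card_eq_ge a b : card_eq a b -> card_le b a.
Proof. by move=> /card_eq_sym /card_eq_le. Qed.

Lemma card_eq_trans a b c : card_eq a b -> card_eq b c -> card_eq a c.
Proof.
move=> [f [[[F Fb] Fi] Fs]] [g [[[G Gb] Gi] Gs]].
apply: (card_eq_intro (fun x z => exists y, maps f x y /\ maps g y z)); first by definable.
- move=> x xa; have [y h] := fn_ex _ _ _ F xa.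
  have [z h'] := fn_ex _ _ _ G (Fb _ _ h).
  by exists z; split; [apply: Gb h'|exists y].
- move=> x z z' xa [y [h1 h2]] [y' [h1' h2']].
  rewrite (fn_uniq _ _ _ _ _ F h1' h1) in h2'.
  exact: (fn_uniq _ _ _ _ _ G h2 h2').
- move=> x x' z xa xa' [y [h1 h2]] [y' [h1' h2']].
  rewrite (Gi _ _ _ h2' h2) in h1'; exact: Fi h1 h1'.
- move=> z /Gs [y h]; have [x h'] := Fs _ (fn_dom _ _ _ _ G h).
  by exists x; split; [apply: fn_dom h'|exists y].
Qed.

Ltac definable_hint4 ::=
  lazymatch goal with
  | |- defn (fun e => function (@?u e) (@?v e) (@?w e)) => apply (defn_function u v w)
  | |- defn (fun e => function_on (@?u e) (@?v e)) => apply (defn_function_on u v)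
  end.

(** * Ordinals *)

Lemma mem_irrefl x : ~ x ∈ x.
Proof.
move=> h; have [|y [/in_upr hy H]] := zf_foundation _ HZF (upr x x).
  by exists x; rewrite in_upr; left.
have e : y = x by tauto.
by apply: (H x); rewrite ?in_upr ?e //; left.
Qed.

Lemma mem_asym x y : x ∈ y -> ~ y ∈ x.
Proof.
move=> h h'; have [|z [/in_upr hz H]] := zf_foundation _ HZF (upr x y).
  by exists x; rewrite in_upr; left.
case: hz => e; subst z.
- by apply: (H y); rewrite ?in_upr //; right.
- by apply: (H x); rewrite ?in_upr //; left.
Qed.

Lemma ord_trans a b c : ordinal a -> b ∈ a -> c ∈ b -> c ∈ a.
Proof. by move=> [T _] /T; apply. Qed.

Lemma ord_in a b : ordinal a -> b ∈ a -> ordinal b.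
Proof.
move=> [T [_ [W2 [W3 W4]]]] ba; have Tb := T _ ba; split.
  move=> y yb z zy; have ya := Tb _ yb.
  exact: (W2 z y b (T _ ya _ zy) ya ba zy yb).
split; first by move=> y _; apply: mem_irrefl.
split; first by move=> u v w /Tb h1 /Tb h2 /Tb h3; apply: W2.
split; first by move=> u v /Tb h1 /Tb h2; apply: W3.
by move=> s S; apply: W4 => z /S /Tb.
Qed.

Lemma ord_initial a c : ordinal a -> subset c a -> transitive c -> c = a \/ c ∈ a.
Proof.
move=> [T [_ [W2 [W3 W4]]]] S Tc.
have [|d Hd] := sep (fun x => ~ x ∈ c) a; first by definable.
have [[x xd]|N] := classic (nonempty d); last first.
  left; apply: ext => z; split=> [/S//|za]; apply: NNPP => zc; apply: N.
  by exists z; rewrite Hd.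
have [z /Hd []//||m [/Hd [ma mc] Hm]] := W4 d; first by exists x.
right; suff -> : c = m by [].
apply: ext => z; split=> zh.
  case: (W3 z m) => //; first exact: S.
  by case=> h; [subst z|case: mc; apply: Tc h].
apply: NNPP => zc; have za : z ∈ a by apply: T zh.
case: (Hm z); first by rewrite Hd.
- by move=> e; subst z; apply: mem_irrefl zh.
- by apply: mem_asym.
Qed.

Lemma ord_cmp a b : ordinal a -> ordinal b -> a ∈ b \/ a = b \/ b ∈ a.
Proof.
move=> oa ob; set c := inter a b.
have Tc : transitive c.
  move=> y /in_inter [ya yb] z zy; rewrite in_inter; split.
  - exact: ord_trans ya zy.
  - exact: ord_trans yb zy.
have [||h|h] // := ord_initial a c oa; first by move=> z /in_inter [].
  have [||h'|h'] // := ord_initial b c ob; first by move=> z /in_inter [].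
    by right; left; rewrite -h -h'.
  by left; rewrite -h.
have [||h'|h'] // := ord_initial b c ob; first by move=> z /in_inter [].
  by right; right; rewrite -h'.
by case: (mem_irrefl c); rewrite {2}/c in_inter.
Qed.

Lemma ord_min (P : M -> Prop) a : defn (fun e => P (e 0)) -> ordinal a -> P a ->
  exists b, ordinal b /\ P b /\ (forall c, c ∈ b -> ~ P c).
Proof.
move=> D oa Pa.
have [//|s Hs] := sep P (adj a a).
have [|m [/Hs [ma Pm] Hm]] := zf_foundation _ HZF s.
  by exists a; rewrite Hs in_adj; tauto.
have om : ordinal m by move/in_adj: ma => [/(ord_in _ _ oa)|->].
exists m; split=> //; split=> // c cm Pc.
apply: (Hm c) => //; rewrite Hs in_adj; split=> //; left.
by move/in_adj: ma => [ma|e]; [apply: ord_trans ma cm|rewrite -e].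
Qed.

Lemma ord_ind (P : M -> Prop) : defn (fun e => P (e 0)) ->
  (forall a, ordinal a -> (forall b, b ∈ a -> P b) -> P a) ->
  forall a, ordinal a -> P a.
Proof.
move=> D H a oa; apply: NNPP => N.
have [|b [ob [Nb Hb]]] := ord_min (fun x => ~ P x) a _ oa N; first by definable.
by apply/Nb/H => // c /Hb /NNPP.
Qed.

Lemma ord_intro a : (forall x, x ∈ a -> ordinal x) -> transitive a -> ordinal a.
Proof.
move=> H T; split=> //; split; first by move=> y _; apply: mem_irrefl.
split; first by move=> u v w _ _ /H ow uv vw; apply: ord_trans vw uv.
split; first by move=> u v /H hu /H; apply: ord_cmp.
move=> s S [x xs].
have [|||m [om [ms Hm]]] := ord_min (fun x => x ∈ s) x; [by definable|exact/H/S|by []|].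
exists m; split=> // u us.
case: (ord_cmp m u) => //; [exact/H/S|tauto|].
by case=> [h|/Hm]; [left|].
Qed.

Lemma ord_adj a : ordinal a -> ordinal (adj a a).
Proof.
move=> oa; apply: ord_intro => [x /in_adj [/(ord_in _ _ oa)|->]//|y /in_adj hy z zy].
by apply/in_adj; left; case: hy => [h|<-//]; apply: ord_trans h zy.
Qed.

Lemma ord_emp : ordinal emp.
Proof. by apply: ord_intro => [x /in_emp|x /in_emp]. Qed.

Lemma ord_subset a b : ordinal a -> ordinal b -> subset a b <-> a ∈ b \/ a = b.
Proof.
move=> oa ob; split=> [S|[h z|-> z]//]; last exact: ord_trans h.
case: (ord_cmp a b) => //; [tauto|case; [tauto|]].
by move=> /S /mem_irrefl.
Qed.

Lemma ord_le a b : ordinal a -> ordinal b -> subset a b \/ b ∈ a.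
Proof.
by move=> oa ob; rewrite ord_subset //; case: (ord_cmp a b) => //; tauto.
Qed.

Lemma ord_le_lt a b c : ordinal a -> ordinal b -> ordinal c ->
  subset a b -> b ∈ c -> a ∈ c.
Proof.
move=> oa ob oc /ord_subset h bc; case: h => // [h|->//].
exact: ord_trans bc h.
Qed.

(** ** Natural numbers *)

Lemma nat_emp : natural emp.
Proof.
split; first exact: ord_emp.
by move=> m [/in_emp//|->]; left; rewrite emptyE.
Qed.

Lemma nat_in n m : natural n -> m ∈ n -> natural m.
Proof.
move=> [on H] mn; split; first exact: ord_in mn.
move=> k [km|->]; apply: H; left => //; exact: ord_trans km.
Qed.

Lemma nat_adj n : natural n -> natural (adj n n).
Proof.
move=> [on H]; split; first exact: ord_adj.
move=> m [/in_adj h|->]; first exact: H.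
by right; exists n; rewrite is_succE.
Qed.

Lemma nat_cases n : natural n -> n = emp \/ exists m, natural m /\ n = adj m m.
Proof.
move=> nn; have [_ H] := nn; case: (H n); first by right.
  by move=> /emptyE; left.
move=> [k /is_succE e]; right; exists k; split=> //.
by apply: (nat_in n) => //; rewrite e in_adj; right.
Qed.

Lemma defn_natural (u : (nat -> M) -> M) : tdef u -> defn (fun e => natural (u e)).
Proof. by apply: defn_subst1; rewrite /natural; definable. Qed.

Lemma nat_ind' (P : M -> Prop) : defn (fun e => P (e 0)) -> P emp ->
  (forall n, natural n -> P n -> P (adj n n)) -> forall n, natural n -> P n.
Proof.
move=> D P0 PS n nn.
apply: (ord_ind (fun n => natural n -> P n)) (proj1 nn) (nn).
  by apply: defn_imp => //; apply: defn_natural; definable.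
move=> a _ IH /nat_cases [->|[m [nm e]]] //; subst a.
by apply: PS => //; apply: IH => //; apply/in_adj; right.
Qed.

Lemma ex_omega : exists w : M, is_omega w.
Proof.
have [v [[z [/emptyE z0 zv]] vS]] := zf_infinity _ HZF; subst z.
have [|w Hw] := sep (natural (M := M)) v; first by apply: defn_natural; definable.
exists w => n; rewrite Hw; split=> [[]//|nn]; split=> //.
apply: (nat_ind' (fun n => n ∈ v)) nn; [by definable|by []|].
by move=> m _ /vS [y [/is_succE -> ]].
Qed.

Definition omega : M := setof (natural (M := M)).

Lemma in_omega n : n ∈ omega <-> natural n.
Proof. by rewrite in_setof //; have [w H] := ex_omega; exists w. Qed.

Lemma is_omegaE (w : M) : is_omega w <-> w = omega.
Proof.
split=> [H|-> n]; last exact: in_omega.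
by apply: ext => z; rewrite H in_omega.
Qed.

Lemma ord_omega : ordinal omega.
Proof.
apply: ord_intro => [x /in_omega []//|x /in_omega nx y yx].
by apply/in_omega; apply: nat_in yx.
Qed.

(** * Order types of well-ordered sets *)

Lemma defn_bijection (u v w : (nat -> M) -> M) : tdef u -> tdef v -> tdef w ->
  defn (fun e => bijection (u e) (v e) (w e)).
Proof. by apply: defn_subst3; rewrite /bijection /injection; definable. Qed.

Lemma defn_injection (u v w : (nat -> M) -> M) : tdef u -> tdef v -> tdef w ->
  defn (fun e => injection (u e) (v e) (w e)).
Proof. by apply: defn_subst3; rewrite /injection; definable. Qed.

Ltac definable_hint5 ::=
  lazymatch goal with
  | |- defn (fun e => bijection (@?u e) (@?v e) (@?w e)) => apply (defn_bijection u v w)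
  | |- defn (fun e => injection (@?u e) (@?v e) (@?w e)) => apply (defn_injection u v w)
  | |- defn (fun e => natural (@?u e)) => apply (defn_natural u)
  | |- defn (fun e => card_eq (@?u e) (@?v e)) => unfold card_eq
  | |- defn (fun e => card_le (@?u e) (@?v e)) => unfold card_le
  | |- defn (fun e => finite (@?u e)) => unfold finite
  end.

Section WellOrder.
Variables (X : M) (lt : M -> M -> Prop).

(** [lt] is a definable class relation, so that the same theory serves [∈] on sets of ordinals and
    [goedel] on pairs. *)
Definition well_order : Prop :=
  (forall x, ~ lt x x) /\
  (forall x y z, x ∈ X -> y ∈ X -> z ∈ X -> lt x y -> lt y z -> lt x z) /\
  (forall x y, x ∈ X -> y ∈ X -> lt x y \/ x = y \/ lt y x) /\
  (forall s, subset s X -> nonempty s ->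
     exists m, m ∈ s /\ forall u, u ∈ s -> ~ lt u m).

Hypothesis (D : defn (fun e => lt (e 0) (e 1))) (W : well_order).

Definition initial b : Prop :=
  subset b X /\ forall x y, y ∈ b -> x ∈ X -> lt x y -> x ∈ b.

Definition iso f i b : Prop :=
  bijection f i b /\
  forall j k x y, maps f j x -> maps f k y -> (j ∈ k <-> lt x y).

Definition seg a : M := setof (fun y => y ∈ X /\ lt y a).

Definition has_type b i : Prop := ordinal i /\ exists f, iso f i b.

Lemma in_seg a y : y ∈ seg a <-> y ∈ X /\ lt y a.
Proof. by rewrite in_setof //; apply: (sep (fun y => lt y a)); definable. Qed.

Lemma tdef_seg (u : (nat -> M) -> M) : tdef u -> tdef (fun e => seg (u e)).
Proof.
by apply: tdef_fun1; apply: (tdef_setof (fun e y => y ∈ X /\ lt y (e 0))); definable.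
Qed.

Lemma defn_iso (u v w : (nat -> M) -> M) : tdef u -> tdef v -> tdef w ->
  defn (fun e => iso (u e) (v e) (w e)).
Proof. by apply: defn_subst3; rewrite /iso; definable. Qed.

Lemma defn_has_type (u v : (nat -> M) -> M) : tdef u -> tdef v ->
  defn (fun e => has_type (u e) (v e)).
Proof.
apply: defn_subst2; rewrite /has_type; definable.
by apply: (defn_iso (fun e => e 0) (fun e => e 2) (fun e => e 1)); definable.
Qed.

Lemma seg_initial a : a ∈ X -> initial (seg a).
Proof.
have [_ [tr _]] := W.
move=> aX; split=> [x /in_seg []//|x y /in_seg [yX ya] xX xy].
by apply/in_seg; split=> //; apply: (tr x y a).
Qed.

(** Induction on [j]. If one value at [j] were smaller, the other isomorphism would attain it at an
    earlier index, where both agree, against injectivity. *)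
Lemma iso_agree f f' i i' b b' : initial b -> initial b' -> ordinal i -> ordinal i' ->
  iso f i b -> iso f' i' b' ->
  forall j x x', maps f j x -> maps f' j x' -> x = x'.
Proof.
have [irr [tr [tot wf]]] := W.
have half g g' k k' d d' j x x' : initial d -> initial d' ->
    iso g k d -> iso g' k' d' -> maps g j x -> maps g' j x' ->
    ordinal k -> ordinal k' ->
    (forall m, m ∈ j -> forall y y', maps g m y -> maps g' m y' -> y = y') ->
    ~ lt x x'.
  move=> [dX _] [d'X d'i] [[[[G Gb] Gi] Gs] Go] [[[[G' G'b] G'i] G's] G'o] h h' ok ok' IH l.
  have xd' : x ∈ d' by apply: (d'i x x') => //; [apply: G'b h'|apply/dX/Gb/h].
  have [m h2] := G's _ xd'.
  have mj : m ∈ j by apply/(G'o _ _ _ _ h2 h').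
  have [y h3] := fn_ex _ _ _ G (ord_trans _ _ _ ok (fn_dom _ _ _ _ G h) mj).
  have e := IH _ mj _ _ h3 h2; subst y.
  by have e := Gi _ _ _ h h3; subst m; apply: mem_irrefl mj.
move=> Ib Ib' oi oi' F F' j x x' h h'.
have oj : ordinal j.
  by apply: ord_in oi _; apply: fn_dom h; case: F => [[[[]]]].
move: j oj x x' h h'.
apply: (ord_ind (fun j => forall x x', maps f j x -> maps f' j x' -> x = x')); first by definable.
move=> j oj IH x x' h h'.
have [[[[_ Fb] _] _] _] := F; have [[[[_ F'b] _] _] _] := F'.
case: (tot x x'); first by apply: (proj1 Ib); apply: Fb h.
- by apply: (proj1 Ib'); apply: F'b h'.
- by move=> l; case: (half f f' i i' b b' j x x').
- case=> // l; case: (half f' f i' i b' b j x' x) => // m mj y y' h1 h2.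
  by rewrite (IH m mj y' y).
Qed.

Lemma iso_index_uniq f f' i i' b b' : initial b -> initial b' -> ordinal i -> ordinal i' ->
  iso f i b -> iso f' i' b' -> i ∈ i' -> exists x, x ∈ b' /\ ~ x ∈ b.
Proof.
move=> Ib Ib' oi oi' F F' ii'.
have [[[[F0 Fb] Fi] Fs] _] := F; have [[[[F'0 F'b] F'i] F's] _] := F'.
have [x h] := fn_ex _ _ _ F'0 ii'.
exists x; split; first exact: F'b h.
move=> /Fs [j hj].
have ji := fn_dom _ _ _ _ F0 hj.
have [y h2] := fn_ex _ _ _ F'0 (ord_trans _ _ _ oi' ii' ji).
have e : x = y by apply: (iso_agree f f' i i' b b') hj h2.
subst y; have e := F'i _ _ _ h h2; subst j; exact: mem_irrefl ji.
Qed.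

Lemma type_uniq b i i' : initial b -> has_type b i -> has_type b i' -> i = i'.
Proof.
move=> Ib [oi [f F]] [oi' [f' F']].
case: (ord_cmp i i') => // [h|[//|h]].
- by have [x []] := iso_index_uniq f f' i i' b b Ib Ib oi oi' F F' h.
- by have [x []] := iso_index_uniq f' f i' i b b Ib Ib oi' oi F' F h.
Qed.

Lemma iso_seg f i b j a : initial b -> ordinal i -> iso f i b -> maps f j a ->
  has_type (seg a) j.
Proof.
move=> [bX bi] oi [[[[F Fb] Fi] Fs] Fo] h.
have ji := fn_dom _ _ _ _ F h.
have ab := Fb _ _ h.
split; first exact: ord_in ji.
have [|x xj|x y y' _|g [G K]] := lam (fun k x => maps f k x) j; first by definable.
- by apply: (fn_ex _ _ _ F); apply: ord_trans xj.
- exact: fn_uniq F.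
exists g; split; first split; first split; first split=> //.
- move=> k x /K [kj h']; rewrite in_seg; split; first exact/bX/Fb/h'.
  by apply/(Fo _ _ _ _ h' h).
- by move=> k k' x /K [_ h1] /K [_ h2]; apply: Fi h1 h2.
- move=> y /in_seg [yX ya]; have [k hk] := Fs _ (bi _ _ ab yX ya).
  by exists k; rewrite K; split=> //; apply/(Fo _ _ _ _ hk h).
- by move=> k k' x y /K [_ h1] /K [_ h2]; apply: Fo.
Qed.

(** The type of [b] is the set of types of the segments below its points. Types are unique, so
    replacement collects them without choosing isomorphisms. *)
Lemma type_step b : initial b ->
  (forall a, a ∈ b -> exists i, has_type (seg a) i) -> exists i, has_type b i.
Proof.
move=> Ib E; have [bX bi] := Ib; have [irr [tr [tot wf]]] := W.
have In a : a ∈ b -> initial (seg a) by move=> /bX; apply: seg_initial.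
have [||l Hl] := repl (fun a i => has_type (seg a) i) b.
- by apply: defn_has_type; [apply: tdef_seg|]; definable.
- by move=> a i i' /In; apply: type_uniq.
have mono a a' i i' : a ∈ b -> a' ∈ b -> has_type (seg a) i -> has_type (seg a') i' ->
    lt a a' -> i ∈ i'.
  move=> ab a'b hi [oi' [f F]] l'.
  have [[[[F0 Fb] Fi] Fs] Fo] := F.
  have [|j h] := Fs a; first by rewrite in_seg; split=> //; apply: bX.
  have hj := iso_seg _ _ _ _ _ (In _ a'b) oi' F h.
  by rewrite (type_uniq _ _ _ (In _ ab) hi hj); apply: fn_dom h.
have ol : ordinal l.
  apply: ord_intro => [i /Hl [a [_ []]]//|i /Hl [a [ab hi]] j ji].
  have [oi [f F]] := hi.
  have [x h] := fn_ex _ _ _ (proj1 (proj1 (proj1 (proj1 F)))) ji.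
  have hj := iso_seg _ _ _ _ _ (In _ ab) oi F h.
  apply/Hl; exists x; split=> //.
  have /in_seg [xX xa] : x ∈ seg a by case: F => [[[[_ Fb] _] _] _]; apply: Fb h.
  exact: bi xa.
exists l; split=> //.
have [|i /Hl [a [ab hi]]|i a a' _ [ab hi] [a'b hi']|g [G K]] :=
  lam (fun i a => a ∈ b /\ has_type (seg a) i) l.
- by definable; apply: (defn_has_type (fun e => seg (e 1)) (fun e => e 0));
     [apply: (tdef_seg (fun e => e 1))|]; definable.
- by exists a.
- case: (tot a a') => [||h|[//|h]]; [exact: bX|exact: bX| |].
  + by case: (mem_irrefl i); apply: (mono a a').
  + by case: (mem_irrefl i); apply: (mono a' a).
exists g; split; first split; first split; first split=> //.
- by move=> i a /K [_ []].
- by move=> i i' a /K [_ [ab h]] /K [_ [_ h']]; apply: (type_uniq (seg a)) => //; apply: In.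
- move=> a ab; have [i hi] := E a ab; exists i; rewrite K; split=> //.
  by apply/Hl; exists a.
- move=> i i' a a' /K [_ [ab h]] /K [_ [a'b h']]; split; last exact: mono.
  move=> ii'; case: (tot a a') => [||h2|[h2|h2]] //; [exact: bX|exact: bX| |].
  + subst a'; have e : i = i' by apply: (type_uniq (seg a)) => //; apply: In.
    by subst i'; case: (mem_irrefl i).
  + by case: (mem_asym _ _ ii'); apply: (mono a' a).
Qed.

Lemma seg_type a : a ∈ X -> exists i, has_type (seg a) i.
Proof.
have [irr [tr [tot wf]]] := W.
move=> aX; apply: NNPP => N.
have [|s Hs] := sep (fun a => ~ exists i, has_type (seg a) i) X.
  by definable; apply: (defn_has_type (fun e => seg (e 1)) (fun e => e 0));
     [apply: (tdef_seg (fun e => e 1))|]; definable.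
have [z /Hs []//||m [/Hs [mX Nm] Hm]] := wf s; first by exists a; rewrite Hs.
apply: Nm; apply: type_step; first exact: seg_initial.
move=> x /in_seg [xX xm]; apply: NNPP => Nx; apply: (Hm x) => //.
by rewrite Hs.
Qed.

Lemma type_ex b : initial b -> exists i, has_type b i.
Proof. by move=> Ib; apply: type_step => // a /(proj1 Ib) /seg_type. Qed.

Definition index a i : Prop := a ∈ X /\ has_type (seg a) i.

Lemma index_ex a : a ∈ X -> exists i, index a i.
Proof. by move=> aX; have [i h] := seg_type a aX; exists i. Qed.

Lemma index_ord a i : index a i -> ordinal i.
Proof. by case=> _ []. Qed.

Lemma index_lt a a' i i' : index a i -> index a' i' -> lt a a' -> i ∈ i'.
Proof.
move=> [aX hi] [a'X [oi' [f F]]] l.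
have [[[[F0 Fb] Fi] Fs] Fo] := F.
have [|j h] := Fs a; first by rewrite in_seg.
have hj := iso_seg _ _ _ _ _ (seg_initial _ a'X) oi' F h.
by rewrite (type_uniq _ _ _ (seg_initial _ aX) hi hj); apply: fn_dom h.
Qed.

Lemma index_inj a a' i : index a i -> index a' i -> a = a'.
Proof.
have [irr [tr [tot wf]]] := W.
move=> h h'; case: (tot a a') => [||l|[//|l]]; [by case: h|by case: h'| |].
- by case: (mem_irrefl i); apply: (index_lt a a').
- by case: (mem_irrefl i); apply: (index_lt a' a).
Qed.

Lemma type_seg b i j : initial b -> has_type b i -> j ∈ i ->
  exists a, a ∈ b /\ index a j.
Proof.
move=> Ib [oi [f F]] ji; have [[[[F0 Fb] Fi] Fs] Fo] := F.
have [a h] := fn_ex _ _ _ F0 ji.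
exists a; split; first exact: Fb h.
split; first by apply: (proj1 Ib); apply: Fb h.
exact: iso_seg Ib oi F h.
Qed.

Lemma type_index b i a j : initial b -> has_type b i -> a ∈ b -> index a j -> j ∈ i.
Proof.
move=> Ib [oi [f F]] ab [aX h]; have [[[[F0 Fb] Fi] Fs] Fo] := F.
have [k hk] := Fs _ ab.
rewrite (type_uniq _ _ _ (seg_initial _ aX) h (iso_seg _ _ _ _ _ Ib oi F hk)).
exact: fn_dom hk.
Qed.

Lemma initial_X : initial X.
Proof. by split. Qed.

Lemma type_card_eq b i : has_type b i -> card_eq i b.
Proof. by move=> [_ [f [F _]]]; exists f. Qed.

End WellOrder.

(** * Cardinals *)

Lemma wo_ords s : (forall x, x ∈ s -> ordinal x) -> well_order s mem.
Proof.
move=> H; split; first exact: mem_irrefl.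
split; first by move=> x y z _ _ /H oz xy yz; apply: ord_trans yz xy.
split; first by move=> x y /H ox /H; apply: ord_cmp.
move=> t S [x xt].
have [|||m [om [mt Hm]]] := ord_min (fun x => x ∈ t) x; [by definable|exact/H/S|by []|].
by exists m; split=> // u ut /Hm.
Qed.

Lemma defn_memr : defn (fun e : nat -> M => e 0 ∈ e 1).
Proof. by definable. Qed.

Definition nth s x i : Prop := index s mem x i.

Lemma nth_ex s x : (forall x, x ∈ s -> ordinal x) -> x ∈ s -> exists i, nth s x i.
Proof. by move=> H; apply: index_ex; [exact: defn_memr|exact: wo_ords]. Qed.

Lemma nth_inj s x y i : (forall x, x ∈ s -> ordinal x) -> nth s x i -> nth s y i -> x = y.
Proof. by move=> H; apply: index_inj; [exact: defn_memr|exact: wo_ords]. Qed.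

Lemma ords_type s : (forall x, x ∈ s -> ordinal x) -> exists l, has_type mem s l.
Proof.
by move=> H; apply: (type_ex s); [exact: defn_memr|exact: wo_ords|exact: initial_X].
Qed.

(** If [x ∈ j], then the value of [f] at the earlier index [x] lies below [x], against the induction
    hypothesis. *)
Lemma iso_ge f i s j x : (forall x, x ∈ s -> ordinal x) -> ordinal i -> iso mem f i s ->
  maps f j x -> subset j x.
Proof.
move=> H oi [[[[F Fb] Fi] Fs] Fo] h.
have oj : ordinal j by apply: ord_in oi _; apply: fn_dom h.
move: j oj x h; apply: (ord_ind (fun j => forall x, maps f j x -> subset j x)); first by definable.
move=> j oj IH x h; have ox : ordinal x by exact: H _ (Fb _ _ h).
case: (ord_le j x) => // xj.
have [|y h'] := fn_ex f i x F; first by apply: ord_trans (fn_dom _ _ _ _ F h) xj.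
have yx : y ∈ x by apply/(Fo _ _ _ _ h' h).
by case: (mem_irrefl y); apply: (IH x).
Qed.

Lemma type_le a s l : ordinal a -> subset s a -> has_type mem s l -> subset l a.
Proof.
move=> oa S [ol [f F]]; have H x : x ∈ s -> ordinal x by move=> /S; apply: ord_in.
case: (ord_le l a) => // al.
have [x h] := fn_ex _ _ _ (proj1 (proj1 (proj1 (proj1 F)))) al.
have xa : x ∈ a by case: F => [[[[_ Fb] _] _] _]; exact: S _ (Fb _ _ h).
by case: (mem_irrefl x); apply: (iso_ge f l s a).
Qed.

Lemma has_type_order h l : ordinal l -> has_type mem h l <-> order_type h l.
Proof. by move=> ol; split=> [[]|]. Qed.

Lemma order_type_card h l : order_type h l -> card_eq l h.
Proof. by move=> [f [F _]]; exists f. Qed.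

Lemma type_shrink s l i : (forall x, x ∈ s -> ordinal x) -> has_type mem s l ->
  ordinal i -> subset i l -> exists h, subset h s /\ order_type h i.
Proof.
move=> H tl oi; have ol := proj1 tl; rewrite ord_subset // => -[il|->]; last first.
  by exists s; split=> //; rewrite -has_type_order.
have [x [xs [_ hx]]] := type_seg _ _ defn_memr s l i (initial_X _ _) tl il.
exists (seg s mem x); split; last by rewrite -has_type_order.
by move=> z; rewrite (in_seg _ _ defn_memr) => -[].
Qed.

(** Largeness is measured by order type: (5) asks for a set of type [k], and when no such subset
    exists all positions in [s] lie below [k], as [small_nth] shows. *)
Definition big k s : Prop := exists h, subset h s /\ order_type h k.

Lemma big_card k s : big k s -> card_le k s.
Proof.
move=> [h [S /order_type_card /card_eq_le h1]].
exact: card_le_trans h1 (card_le_subset _ _ S).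
Qed.

Lemma small_nth k s x i : ordinal k -> (forall x, x ∈ s -> ordinal x) -> ~ big k s ->
  nth s x i -> i ∈ k.
Proof.
move=> ok H N h; have oi := index_ord _ _ _ _ h.
have [l tl] := ords_type s H.
case: (ord_le k i) => // ki; case: N.
apply: (type_shrink s l) => // z /ki zi.
have il := type_index _ _ defn_memr (wo_ords _ H) s l x i (initial_X _ _) tl (proj1 h) h.
exact: ord_trans (proj1 tl) il zi.
Qed.

Lemma card_le_image a b : card_le a b -> exists s, subset s b /\ card_eq a s.
Proof.
move=> [f [[F Fb] Fi]].
have [|s Hs] := sep (fun y => exists x, maps f x y) b; first by definable.
exists s; split; first by move=> y /Hs [].
exists f; split; last by move=> y /Hs [].
split=> //; split=> // x y h; rewrite Hs; split; first exact: Fb h.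
by exists x.
Qed.

(** The image of an injection is a subset of [a], so its order type is at most [a], and [k] would be
    equinumerous with a smaller ordinal. *)
Lemma card_no_inj k a : cardinal k -> a ∈ k -> ~ card_le k a.
Proof.
move=> [ok Hk] ak /card_le_image [s [S E]].
have oa := ord_in _ _ ok ak.
have [x /S|l tl] := ords_type s; first exact: ord_in.
have la := type_le _ _ _ oa S tl; have ol := proj1 tl.
apply: (Hk l).
  exact: ord_le_lt la ak.
by apply: card_eq_trans (card_eq_sym _ _ E); case: tl => _ [f [h _]]; exists f.
Qed.

(** Since [k] is an ordinal, order types replace the Cantor-Bernstein construction: the image of [x]
    in [k] has a type at most [k], and [card_no_inj] rules out a smaller one. *)
Lemma card_le_antisym k x : cardinal k -> card_le k x -> card_le x k -> card_eq x k.
Proof.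
move=> ck kx /card_le_image [s [S E]]; have ok := proj1 ck.
have [y /S|l tl] := ords_type s; first exact: ord_in.
have ol := proj1 tl; have lk := type_le _ _ _ ok S tl.
have ls := type_card_eq _ _ _ tl.
have kl : card_le k l.
  apply: card_le_trans kx _; apply: card_le_trans (card_eq_le _ _ E) (card_eq_ge _ _ ls).
move/ord_subset: lk => -[//|//|lk|e]; first by case: (card_no_inj _ _ ck lk).
by rewrite -e; apply: card_eq_trans E (card_eq_sym _ _ ls).
Qed.

(** [R] may relate one [x] to several codes. The codes are ordinals, so taking the least one gives a
    function without choice. *)
Lemma card_le_least (R : M -> M -> Prop) s k : defn (fun e => R (e 0) (e 1)) -> ordinal k ->
  (forall x, x ∈ s -> exists y, y ∈ k /\ R x y) ->
  (forall x x' y, x ∈ s -> x' ∈ s -> R x y -> R x' y -> x = x') ->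
  card_le s k.
Proof.
move=> D ok E I.
apply: (card_le_intro (fun x y => y ∈ k /\ R x y /\ forall z, z ∈ y -> ~ R x z)).
- by definable.
- move=> x /E [y [yk h]]; have oy := ord_in _ _ ok yk.
  have [|m [om [mh Hm]]] := ord_min (R x) y _ (ord_in _ _ ok yk) h.
    exact: (defn_subst2 R (fun _ => x) (fun e => e 0) D (tdef_const x) (tdef_var 0)).
  have mk : m ∈ k.
    case: (ord_le m y) => // [my|/Hm []//].
    exact: ord_le_lt my yk.
  by exists m.
- move=> x y y' _ [yk [h H]] [yk' [h' H']].
  by case: (ord_cmp y y') => // [||/H'|[//|/H]] //; [exact: ord_in yk|exact: ord_in yk'].
- by move=> x x' y xs xs' [_ [h _]] [_ [h' _]]; apply: (I x x' y).
Qed.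

(** ** The successor cardinal *)

Lemma ord_type_self a : ordinal a -> has_type mem a a.
Proof.
move=> oa; split=> //.
have [|x xa|x y y' _ <- <-|f [F K]] // := lam eq a; [by definable|by exists x|].
exists f; split; first split; first split; first split=> //.
- by move=> x y /K [xa <-].
- by move=> x x' y /K [_ ->] /K [_ ->].
- by move=> y ya; exists y; rewrite K.
- by move=> x y x' y' /K [_ <-] /K [_ <-].
Qed.

Lemma ord_iso_eq a b s (lt : M -> M -> Prop) f g : ordinal a -> ordinal b ->
  iso lt f a s -> iso lt g b s -> a = b.
Proof.
move=> oa ob [[[[F Fb] Fi] Fs] Fo] [[[[G Gb] Gi] Gs] Go].
have Hb x : x ∈ b -> ordinal x by apply: ord_in.
apply: (type_uniq _ _ (wo_ords _ Hb) b); [exact: initial_X| |exact: ord_type_self].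
split=> //.
have [|i ia|i j j' _ [x [h1 h2]] [x' [h1' h2']]|u [U K]] :=
  lam (fun i j => exists x, maps f i x /\ maps g j x) a; first by definable.
- have [x h] := fn_ex _ _ _ F ia; have [j h'] := Gs _ (Fb _ _ h).
  by exists j, x.
- rewrite (fn_uniq _ _ _ _ _ F h1' h1) in h2'; exact: Gi h2 h2'.
exists u; split; first split; first split; first split=> //.
- by move=> i j /K [_ [x [_ h]]]; apply: fn_dom h.
- move=> i i' j /K [_ [x [h1 h2]]] /K [_ [x' [h1' h2']]].
  rewrite (fn_uniq _ _ _ _ _ G h2' h2) in h1'; exact: Fi h1 h1'.
- move=> j jb; have [x h] := fn_ex _ _ _ G jb; have [i h'] := Fs _ (Gb _ _ h).
  by exists i; rewrite K; split; [apply: fn_dom h'|exists x].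
- move=> i i' j j' /K [_ [x [h1 h2]]] /K [_ [x' [h1' h2']]].
  by rewrite (Fo _ _ _ _ h1 h1') (Go _ _ _ _ h2 h2').
Qed.

(* The ordinals that inject into [k] are the order types of the pairs [(s, r)],
   [r] a well-order of [s ⊂ k], so replacement collects them into a set. *)
Lemma hartogs k : exists m, forall a, a ∈ m <-> ordinal a /\ card_le a k.
Proof.
pose Q c a := exists s r, c = pr s r /\ ordinal a /\ exists f,
  bijection f a s /\
  forall i j x y, maps f i x -> maps f j y -> (i ∈ j <-> pr x y ∈ r).
have [||m Hm] := repl Q (prod (pow k) (pow (prod k k))).
- by rewrite /Q; definable.
- move=> c a a' _ [s [r [-> [oa [f F]]]]] [s' [r' [/pr_inj [<- <-] [oa' [f' F']]]]].
  exact: (ord_iso_eq a a' s (fun x y => pr x y ∈ r) f f').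
exists m => a; rewrite Hm; split.
  move=> [c [/in_prod [s [r [sk [_ ->]]]] [s' [r' [/pr_inj [<- _] [oa [f [F _]]]]]]]].
  split=> //; apply: (card_le_trans _ s); first by apply: card_eq_le; exists f.
  by apply/card_le_subset/in_pow.
move=> [oa /card_le_image [s [S [f F]]]].
have [|r Hr] := sep (fun p => exists i j x y, p = pr x y /\ maps f i x /\ maps f j y /\ i ∈ j)
                    (prod k k); first by definable.
exists (pr s r); split.
  by apply/pr_in_prod; rewrite !in_pow; split=> // z /Hr [].
exists s, r; split=> //; split=> //; exists f; split=> //.
move: F => [[[F Fb] Fi] Fs] i j x y hx hy; rewrite Hr pr_in_prod; split.
  move=> ij; split; first by split; apply/S/Fb; [exact: hx|exact: hy].
  by exists i, j, x, y.
move=> [_ [i' [j' [x' [y' [/pr_inj [<- <-] [hx' [hy' ij]]]]]]]].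
by rewrite (Fi _ _ _ hx hx') (Fi _ _ _ hy hy').
Qed.

Lemma hartogs_succ k m : cardinal k -> (forall a, a ∈ m <-> ordinal a /\ card_le a k) ->
  is_cardinal_succ k m /\ ~ card_le m k.
Proof.
move=> ck Hm; have ok := proj1 ck.
have om : ordinal m.
  apply: ord_intro => [x /Hm []//|x /Hm [ox xk] y yx]; apply/Hm.
  split; first exact: ord_in yx.
  by apply: card_le_trans xk; apply: card_le_subset => z; apply: ord_trans yx.
have N : ~ card_le m k by move=> h; apply: (mem_irrefl m); apply/Hm.
split=> //; split; first split=> //.
  by move=> a /Hm [_ ak] E; apply: N; apply: card_le_trans ak; apply: card_eq_ge.
split; first by apply/Hm; split=> //; apply: card_le_refl.
move=> n cn kn; have on := proj1 cn.
case: (ord_cmp m n) => // [|[|/Hm [_ h]]]; [by right|by left|].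
by case: (card_no_inj _ _ cn kn).
Qed.

(** ** Finite sets and infinite cardinals *)

Lemma card_eq_refl a : card_eq a a.
Proof.
by apply: (card_eq_intro eq);
  [definable|move=> x xa; exists x|move=> x y y' _ <- <-|move=> x y z _ _ -> ->|move=> y ya; exists y].
Qed.

Lemma omega_le k : infinite_cardinal k -> subset omega k.
Proof.
move=> [[ok _] N]; case: (ord_le omega k) => //; first exact: ord_omega.
move=> /in_omega nk; case: N; exists k; split=> //; exact: card_eq_refl.
Qed.

Lemma nat_in_card k n : infinite_cardinal k -> natural n -> n ∈ k.
Proof. by move=> /omega_le H /in_omega; apply: H. Qed.

Lemma card_limit k a : infinite_cardinal k -> a ∈ k -> adj a a ∈ k.
Proof.
move=> ik ak; have ck := proj1 ik; have ok := proj1 ck; have oa := ord_in _ _ ok ak.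
case: (ord_cmp (adj a a) k) => // [|[e|h]]; first exact: ord_adj; last first.
  by move/in_adj: h => [/(mem_asym _ _ ak)//|e]; rewrite e in ak; case: (mem_irrefl a).
case: (card_no_inj k a ck ak); rewrite -e.
have Na : ~ natural a.
  by move=> /nat_adj /(nat_in_card k _ ik); rewrite e => /mem_irrefl.
have wa : subset omega a.
  case: (ord_le omega a) => //; [exact: ord_omega|by move=> /in_omega].
(* Hilbert's hotel: [a] moves to 0, the natural numbers shift up by one, and everything else
   stays. *)
apply: (card_le_intro (fun x y => (x = a /\ y = emp) \/ (natural x /\ y = adj x x) \/
                                 (x <> a /\ ~ natural x /\ y = x))).
- by definable.
- move=> x /in_adj xa.
  have [nx|Nx] := classic (natural x).
    exists (adj x x); split; last by tauto.
    by apply/wa/in_omega/nat_adj.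
  case: xa => [xa|->]; last by exists emp; split; [apply/wa/in_omega/nat_emp|tauto].
  exists x; split=> //; right; right; split=> // e'; subst x; exact: mem_irrefl xa.
- by move=> x y y' _ [[h1 ->]|[[h1 ->]|[h1 [h2 ->]]]]
    [[h3 ->]|[[h3 ->]|[h3 [h4 ->]]]] //; subst; tauto.
- have ne x : emp <> adj x x by move=> E; apply/(in_emp x); rewrite E in_adj; right.
  move=> x x' y _ _ [[-> ->]|[[h ->]|[h [h' ->]]]] [[-> E]|[[h2 E]|[h2 [h2' E]]]] //.
  + by case: (ne x').
  + by case: h2'; rewrite -E; apply: nat_emp.
  + by case: (ne x).
  + have : x ∈ adj x' x' by rewrite -E in_adj; right.
    have : x' ∈ adj x x by rewrite E in_adj; right.
    by rewrite !in_adj => -[/mem_asym h3 []//|->].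
  + by case: h2'; rewrite -E; apply: nat_adj.
  + by case: h'; rewrite E; apply: nat_emp.
  + by case: h'; rewrite E; apply: nat_adj.
Qed.

Lemma adj_inj x y : adj x x = adj y y -> x = y.
Proof.
move=> E; have : x ∈ adj y y by rewrite -E in_adj; right.
have : y ∈ adj x x by rewrite E in_adj; right.
by rewrite !in_adj => -[/mem_asym h []//|->].
Qed.

Lemma finite_emp : finite emp.
Proof. by exists emp; split; [apply: nat_emp|apply: card_eq_refl]. Qed.

Lemma finite_adj a x : finite a -> finite (adj a x).
Proof.
have [xa|xa] := classic (x ∈ a).
  by suff -> : adj a x = a by []; apply: ext => z; rewrite in_adj; split=> [[|->]|] //; left.
move=> [n [nn [f [[[F Fb] Fi] Fs]]]]; exists (adj n n); split; first exact: nat_adj.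
apply: (card_eq_intro (fun y j => maps f y j \/ (y = x /\ j = n))); first by definable.
- move=> y /in_adj [ya|->]; last by exists n; rewrite in_adj; tauto.
  have [j h] := fn_ex _ _ _ F ya; exists j; rewrite in_adj; split; last by left.
  by left; apply: Fb h.
- move=> y j j' _ [h|[e ->]] [h'|[e' ->]] //; first exact: (fn_uniq _ _ _ _ _ F h h').
  + by subst y; case: xa; apply: fn_dom h.
  + by subst y; case: xa; apply: fn_dom h'.
- move=> y y' j _ _ [h|[-> e]] [h'|[-> e']] //; first exact: (Fi _ _ _ h h').
  + by subst j; case: (mem_irrefl n); apply: Fb h.
  + by subst j; case: (mem_irrefl n); apply: Fb h'.
- move=> j /in_adj [/Fs [y h]|->]; last by exists x; rewrite in_adj; tauto.
  by exists y; rewrite in_adj; split; left=> //; apply: fn_dom h.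
Qed.

Definition del a x : M := setof (fun z => z ∈ a /\ z <> x).

Lemma in_del a x z : z ∈ del a x <-> z ∈ a /\ z <> x.
Proof. by rewrite in_setof //; apply: (sep (fun z => z <> x)); definable. Qed.

Lemma card_del a x n : card_eq a (adj n n) -> x ∈ a -> card_eq (del a x) n.
Proof.
move=> [f [[[F Fb] Fi] Fs]] xa; have [m hm] := fn_ex _ _ _ F xa.
have [w hw] : exists w, maps f w n by apply: Fs; rewrite in_adj; right.
(* The value [n] has to disappear: the point sent to [n], if it is not [x], takes over the value [m]
   given up by [x]. *)
apply: (card_eq_intro (fun y j => (j <> n /\ maps f y j) \/ (maps f y n /\ j = m))).
- by definable.
- move=> y /in_del [ya yx]; have [j h] := fn_ex _ _ _ F ya.
  have [e|jn] := classic (j = n); last first.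
    by exists j; split; [move/in_adj: (Fb _ _ h) => -[]|left].
  subst j; exists m; split; last by right.
  move/in_adj: (Fb _ _ hm) => -[//|e]; subst m.
  by case: yx; apply: Fi h hm.
- move=> y j j' _ [[jn h]|[h ->]] [[jn' h']|[h' ->]] //; first exact: (fn_uniq _ _ _ _ _ F h h').
  + by case: jn; apply: (fn_uniq _ _ _ _ _ F h h').
  + by case: jn'; apply: (fn_uniq _ _ _ _ _ F h' h).
- move=> y y' j /in_del [ya yx] /in_del [ya' yx'] [[jn h]|[h e]] [[jn' h']|[h' e']].
  + exact: (Fi _ _ _ h h').
  + by subst j; case: yx; apply: (Fi _ _ _ h hm).
  + by subst j; case: yx'; apply: (Fi _ _ _ h' hm).
  + exact: (Fi _ _ _ h h').
- move=> j jn.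
  have jn' : j <> n by move=> e; subst j; apply: mem_irrefl jn.
  have [y h] : exists y, maps f y j by apply: Fs; rewrite in_adj; left.
  have [e|yx] := classic (y = x); last first.
    by exists y; rewrite in_del; split; [split=> //; apply: fn_dom h|left].
  subst y; have e := fn_uniq _ _ _ _ _ F h hm; subst m.
  exists w; rewrite in_del; split; last by right.
  split; first exact: fn_dom hw.
  by move=> e; subst w; case: jn'; apply: (fn_uniq _ _ _ _ _ F h hw).
Qed.

Lemma card_eq_emp a : card_eq a emp -> a = emp.
Proof.
move=> [f [[[F Fb] _] _]]; apply: ext => z; split=> [za|/in_emp//].
by have [y /Fb /in_emp] := fn_ex _ _ _ F za.
Qed.

Lemma finite_ind (P : M -> Prop) : defn (fun e => P (e 0)) -> P emp ->
  (forall a x, finite a -> P a -> P (adj a x)) -> forall a, finite a -> P a.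
Proof.
move=> D P0 PS a [n [nn h]]; move: n nn a h.
apply: (nat_ind' (fun n => forall a, card_eq a n -> P a)); first by definable.
  by move=> a /card_eq_emp ->.
move=> n nn IH a h.
have [x xa] : exists x, x ∈ a.
  have [f [[[F _] _] Fs]] := h; have [|x hx] := Fs n; first by rewrite in_adj; right.
  by exists x; apply: fn_dom hx.
have dn := card_del _ _ _ h xa.
have -> : a = adj (del a x) x.
  apply: ext => z; rewrite in_adj in_del; split=> [za|[[]|->]] //.
  by have [|zx] := classic (z = x); [right|left].
by apply: PS; [exists n|apply: IH].
Qed.

Definition cup a b : M := un (upr a b).

Lemma in_cup a b z : z ∈ cup a b <-> z ∈ a \/ z ∈ b.
Proof.
rewrite in_un; split=> [[y [/in_upr [->|->]]]|[h|h]]; [by left|by right| |].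
- by exists a; rewrite in_upr; tauto.
- by exists b; rewrite in_upr; tauto.
Qed.

Lemma finite_cup a b : finite a -> finite b -> finite (cup a b).
Proof.
move=> fa fb; move: b fb; apply: finite_ind.
- by rewrite /cup; definable.
- suff -> : cup a emp = a by [].
  by apply: ext => z; rewrite in_cup in_emp; tauto.
- move=> b x fb fab.
  have -> : cup a (adj b x) = adj (cup a b) x.
    by apply: ext => z; rewrite !(in_cup, in_adj); tauto.
  exact: finite_adj.
Qed.

Lemma finite_image (F : M -> M) a : defn (fun e => e 0 = F (e 1)) -> finite a ->
  finite (setof (fun y => exists x, x ∈ a /\ y = F x)).
Proof.
move=> D; have D' : defn (fun e => e 1 = F (e 0)).
  exact: (defn_ren (fun n : nat => match n with 0 => 1 | 1 => 0 | n => n end) _ D).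
have S b y : y ∈ setof (fun y => exists x, x ∈ b /\ y = F x) <-> exists x, x ∈ b /\ y = F x.
  by rewrite in_setof //; apply: (repl (fun x y => y = F x)) => // x z z' _ -> ->.
move: a; apply: finite_ind; first by definable.
- suff -> : setof (fun y => exists x, x ∈ emp /\ y = F x) = emp by apply: finite_emp.
  by apply: ext => z; rewrite S in_emp; split=> [[x [/in_emp]]|].
- move=> a x fa IH.
  suff -> : setof (fun y => exists x0, x0 ∈ adj a x /\ y = F x0) =
            adj (setof (fun y => exists x, x ∈ a /\ y = F x)) (F x) by apply: finite_adj.
  apply: ext => z; rewrite in_adj !S; split.
    by move=> [y [/in_adj [ya|->] ->]]; [left; exists y|right].
  by move=> [[y [ya ->]]|->]; [exists y|exists x]; rewrite in_adj; tauto.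
Qed.

Lemma finite_prod a b : finite a -> finite b -> finite (prod a b).
Proof.
move=> fa fb; move: b fb; apply: finite_ind.
- by rewrite /prod; definable.
- suff -> : prod a emp = emp by apply: finite_emp.
  by apply: ext => z; rewrite in_prod in_emp; split=> // -[x [y [_ [/in_emp]]]].
- move=> b y fb IH.
  suff -> : prod a (adj b y) =
      cup (prod a b) (setof (fun p => exists x, x ∈ a /\ p = pr x y)).
    by apply: finite_cup => //; apply: finite_image => //; definable.
  apply: ext => z; rewrite in_cup in_setof.
    by apply: (repl (fun x p => p = pr x y)); [definable|move=> x p p' _ -> ->].
  rewrite !in_prod; split.
    move=> [x [y' [xa [/in_adj [yb|->] ->]]]]; last by right; exists x.
    by left; exists x, y'.
  move=> [[x [y' [xa [yb ->]]]]|[x [xa ->]]].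
    by exists x, y'; rewrite in_adj; split=> //; split=> //; left.
  by exists x, y; rewrite in_adj; split=> //; split=> //; right.
Qed.

Lemma finite_not_ge k a : infinite_cardinal k -> finite a -> ~ card_le k a.
Proof.
move=> ik [n [nn /card_eq_le h]] h'.
apply: (card_no_inj k n); [exact: (proj1 ik)|exact: nat_in_card|].
exact: card_le_trans h' h.
Qed.

(** ** Squares of infinite cardinals *)

(** Goedel's order on pairs of ordinals: first by the maximum, which for ordinals is the union, then
    lexicographically. It keeps the predecessors of a pair inside a small square. *)
Definition goedel p q : Prop := exists a b c d, p = pr a b /\ q = pr c d /\
  (cup a b ∈ cup c d \/ (cup a b = cup c d /\ (a ∈ c \/ (a = c /\ b ∈ d)))).

Lemma defn_goedel : defn (fun e => goedel (e 0) (e 1)).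
Proof. by rewrite /goedel /cup; definable. Qed.

Lemma goedel_pr a b c d : goedel (pr a b) (pr c d) <->
  (cup a b ∈ cup c d \/ (cup a b = cup c d /\ (a ∈ c \/ (a = c /\ b ∈ d)))).
Proof.
split=> [[a' [b' [c' [d' [/pr_inj [<- <-] [/pr_inj [<- <-]]]]]]]|h] //.
by exists a, b, c, d.
Qed.

Lemma cup_max a b : ordinal a -> ordinal b ->
  (cup a b = a /\ (b ∈ a \/ b = a)) \/ (cup a b = b /\ (a ∈ b \/ a = b)).
Proof.
move=> oa ob.
have H x y : subset x y -> cup x y = y.
  by move=> S; apply: ext => z; rewrite in_cup; split=> [[/S|]|]; tauto.
have C x y : cup x y = cup y x by apply: ext => z; rewrite !in_cup; tauto.
case: (ord_le a b) => // [S|ba].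
  by right; rewrite H // -ord_subset.
left; rewrite C H; last by split=> //; left.
by apply/ord_subset => //; left.
Qed.

Lemma cup_ord a b : ordinal a -> ordinal b -> ordinal (cup a b).
Proof. by move=> oa ob; case: (cup_max a b) => // -[-> _]. Qed.

Lemma goedel_wo k : ordinal k -> well_order (prod k k) goedel.
Proof.
move=> ok.
have ordk x : x ∈ k -> ordinal x by apply: ord_in.
split.
  move=> x [a [b [c [d [-> [/pr_inj [<- <-]]]]]]].
  by case=> [/mem_irrefl|[_ [/mem_irrefl|[_ /mem_irrefl]]]].
split.
  move=> x y z /in_prod [a [b [ak [bk ->]]]] /in_prod [c [d [ck [dk ->]]]]
    /in_prod [e [f [ek [fk ->]]]]; rewrite !goedel_pr.
  have oe := ordk _ ek; have of' := ordk _ fk; have om := cup_ord _ _ oe of'.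
  case=> [h|[-> h]] [h'|[<- h']].
  - by left; apply: ord_trans h' h.
  - by left.
  - by left.
  - right; split=> //; case: h => [h|[-> h]]; case: h' => [h'|[<- h']].
    + by left; apply: ord_trans h' h.
    + by left.
    + by left.
    + by right; split=> //; apply: ord_trans h' h.
split.
  move=> x y /in_prod [a [b [ak [bk ->]]]] /in_prod [c [d [ck [dk ->]]]]; rewrite !goedel_pr.
  have oa := ordk _ ak; have ob := ordk _ bk; have oc := ordk _ ck; have od := ordk _ dk.
  case: (ord_cmp (cup a b) (cup c d)) => [||h|[E|h]]; [exact: cup_ord|exact: cup_ord|tauto| |tauto].
  case: (ord_cmp a c) => // [h|[e|h]]; [tauto| |by right; right; right; split; [|left]].
  subst c; case: (ord_cmp b d) => // [h|[->|h]]; [tauto|tauto|].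
  by right; right; right; split=> //; right.
move=> s S [p ps].
have Sk a b : pr a b ∈ s -> ordinal a /\ ordinal b.
  by move=> /S /pr_in_prod [/ordk ? /ordk ?].
have /in_prod [a0 [b0 [_ [_ E0]]]] := S _ ps; subst p; have [oa0 ob0] := Sk _ _ ps.
have [||m [om [[a1 [b1 [h1 E1]]] Hm]]] :=
  ord_min (fun m => exists a b, pr a b ∈ s /\ m = cup a b) (cup a0 b0) _ (cup_ord _ _ oa0 ob0).
- by rewrite /cup; definable.
- by exists a0, b0.
have [oa1 ob1] := Sk _ _ h1.
have [||a [oa [[b2 [h2 E2]] Ha]]] :=
  ord_min (fun a => exists b, pr a b ∈ s /\ m = cup a b) a1 _ oa1.
- by rewrite /cup; definable.
- by exists b1.
have [_ ob2] := Sk _ _ h2.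
have [||b [ob [[h3 E3] Hb]]] :=
  ord_min (fun b => pr a b ∈ s /\ m = cup a b) b2 _ ob2.
- by rewrite /cup; definable.
- by [].
exists (pr a b); split=> // u us.
have /in_prod [c [d [_ [_ E]]]] := S _ us; subst u; rewrite goedel_pr -E3.
case=> [h|[E [h|[e h]]]].
- by apply: Hm h _; exists c, d.
- by apply: Ha h _; exists d.
- by subst c; apply: Hb h _.
Qed.

Lemma defn_infinite_cardinal (u : (nat -> M) -> M) : tdef u ->
  defn (fun e => infinite_cardinal (u e)).
Proof. by apply: defn_subst1; rewrite /infinite_cardinal /cardinal; definable. Qed.

Lemma prod_card_le a b : card_le a b -> card_le (prod a a) (prod b b).
Proof.
move=> [f [[F Fb] Fi]].
apply: (card_le_intro (fun p q => exists x y x' y', p = pr x y /\ q = pr x' y' /\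
  maps f x x' /\ maps f y y')); first by definable.
- move=> p /in_prod [x [y [xa [ya ->]]]].
  have [x' hx] := fn_ex _ _ _ F xa; have [y' hy] := fn_ex _ _ _ F ya.
  exists (pr x' y'); rewrite pr_in_prod; split; first by split; [exact: Fb hx|exact: Fb hy].
  by exists x, y, x', y'.
- move=> p q q' _ [x [y [x' [y' [-> [-> [h1 h2]]]]]]]
    [u [v [u' [v' [/pr_inj [<- <-] [-> [h1' h2']]]]]]].
  by rewrite (fn_uniq _ _ _ _ _ F h1 h1') (fn_uniq _ _ _ _ _ F h2 h2').
- move=> p p' q _ _ [x [y [x' [y' [-> [-> [h1 h2]]]]]]]
    [u [v [u' [v' [-> [/pr_inj [<- <-] [h1' h2']]]]]]].
  by rewrite (Fi _ _ _ h1 h1') (Fi _ _ _ h2 h2').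
Qed.

Lemma card_of a : ordinal a -> exists l, cardinal l /\ card_eq l a /\ subset l a.
Proof.
move=> oa.
have [||l [ol [E H]]] := ord_min (fun l => card_eq l a) a _ oa.
- by definable.
- exact: card_eq_refl.
exists l; split; first split=> //.
  by move=> b bl E'; apply: (H b bl); apply: card_eq_trans E' E.
split=> //; case: (ord_le l a) => // al.
by case: (H a al); apply: card_eq_refl.
Qed.

(** Induction on [k]. If the type of [prod k k] exceeded [k], some pair would have exactly [k] as
    the type of its predecessors. These lie in [prod m m] with [m ∈ k] one above the maximum of the
    pair, and that square is finite or, by induction, no larger than the cardinality of [m]. *)
Lemma square_le k : infinite_cardinal k -> card_le (prod k k) k.
Proof.
move=> ik; have ok := proj1 (proj1 ik); move: k ok ik.
apply: (ord_ind (fun k => infinite_cardinal k -> card_le (prod k k) k)).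
  apply: defn_imp; first by apply: defn_infinite_cardinal; definable.
  by rewrite /prod; definable.
move=> k ok IH ik; have ck := proj1 ik.
have W := goedel_wo k ok; have D := defn_goedel.
have [l tl] := type_ex _ _ D W _ (initial_X _ _).
have ol := proj1 tl.
case: (ord_le l k) => // [lk|kl].
  by apply: card_le_trans (card_le_subset _ _ lk); apply/card_eq_ge/(type_card_eq goedel).
have [p [pX [_ hp]]] := type_seg _ _ D _ _ _ (initial_X _ _) tl kl.
have /in_prod [a [b [ak [bk E]]]] := pX; subst p.
have oa := ord_in _ _ ok ak; have ob := ord_in _ _ ok bk.
set m := adj (cup a b) (cup a b).
have cm : cup a b ∈ k by case: (cup_max a b) => // -[-> _].
have mk : m ∈ k by apply: card_limit.
have om := ord_in _ _ ok mk.
have kmm : card_le k (prod m m).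
  apply: (card_le_trans _ (seg (prod k k) goedel (pr a b))).
    exact/card_eq_le/(type_card_eq goedel).
  apply: card_le_subset => p; rewrite (in_seg _ _ D) => -[/in_prod [x [y [xk [yk ->]]]]].
  have ox := ord_in _ _ ok xk; have oy := ord_in _ _ ok yk.
  rewrite goedel_pr => h.
  have {}h : cup x y ∈ m by rewrite in_adj; tauto.
  rewrite pr_in_prod; split; [apply: (ord_le_lt x (cup x y))|apply: (ord_le_lt y (cup x y))] => //.
  - exact: cup_ord.
  - by move=> z zx; rewrite in_cup; left.
  - exact: cup_ord.
  - by move=> z zx; rewrite in_cup; right.
have [fm|nfm] := classic (finite m).
  by case: (finite_not_ge k (prod m m) ik) => //; apply: finite_prod.
have [c [cc [E S]]] := card_of m om.
have ckk : c ∈ k by apply: (ord_le_lt c m) => //; exact: (proj1 cc).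
have ic : infinite_cardinal c.
  split=> // -[n [nn h]]; apply: nfm; exists n; split=> //.
  by apply: card_eq_trans h; apply: card_eq_sym.
case: (card_no_inj k c ck ckk).
apply: card_le_trans kmm _; apply: card_le_trans (prod_card_le _ _ (card_eq_ge _ _ E)) _.
exact: IH.
Qed.

Lemma app_maps f a x y : function_on f a -> maps f x y -> app f x = y.
Proof.
move=> F h.
have K z : (exists y', pr x y' ∈ f /\ z ∈ y') <-> z ∈ y.
  split=> [[y' [/mapsE h' zy]]|zy]; first by rewrite (fn_uniq _ _ _ _ _ F h h').
  by exists y; rewrite -mapsE.
apply: ext => z; rewrite /app in_setof //; exists y => t; exact: iff_sym (K t).
Qed.

(** * Greedy sets *)

Section Greedy.
Variables (S : M) (Q : M -> M -> Prop).
Hypotheses (oS : ordinal S) (D : defn (fun e => Q (e 0) (e 1))).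

(* Recursion on [x ∈ S] deciding [x ∈ b] by [Q (b ∩ x) x]. *)
Definition greedy_below b g : Prop := subset b g /\
  forall x, x ∈ g -> (x ∈ b <-> x ∈ S /\ Q (inter b x) x).

Lemma defn_greedy_below (u v : (nat -> M) -> M) : tdef u -> tdef v ->
  defn (fun e => greedy_below (u e) (v e)).
Proof. by apply: defn_subst2; rewrite /greedy_below; definable. Qed.

Lemma greedy_agree b b' g g' : ordinal g -> ordinal g' ->
  greedy_below b g -> greedy_below b' g' ->
  forall x, ordinal x -> x ∈ g -> x ∈ g' -> (x ∈ b <-> x ∈ b').
Proof.
move=> og og' [_ H] [_ H'].
apply: (ord_ind (fun x => x ∈ g -> x ∈ g' -> (x ∈ b <-> x ∈ b'))); first by definable.
move=> x ox IH xg xg'; rewrite (H _ xg) (H' _ xg').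
suff -> : inter b x = inter b' x by [].
apply: ext => z; rewrite !in_inter; split=> -[zb zx]; split=> //.
- by apply/IH => //; [exact: ord_trans xg zx|exact: ord_trans xg' zx].
- by apply/IH => //; [exact: ord_trans xg zx|exact: ord_trans xg' zx].
Qed.

Lemma greedy_below_inter b g x : ordinal g -> greedy_below b g -> x ∈ g ->
  greedy_below (inter b x) x.
Proof.
move=> og [S1 H] xg; split=> [z /in_inter []//|z zx].
have zg := ord_trans _ _ _ og xg zx.
have -> : inter (inter b x) z = inter b z.
  apply: ext => t; rewrite !in_inter; split=> [[[]]|[tb tz]] //.
  by split=> //; split=> //; apply: ord_trans zx tz; apply: ord_in xg.
by rewrite in_inter (H z zg); tauto.
Qed.

Lemma greedy_below_uniq b b' g : ordinal g -> greedy_below b g -> greedy_below b' g -> b = b'.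
Proof.
move=> og B B'; have [S1 _] := B; have [S1' _] := B'.
apply: ext => z; split=> zh.
- by have zg := S1 _ zh; rewrite -(greedy_agree b b' g g) //; apply: ord_in zg.
- by have zg := S1' _ zh; rewrite (greedy_agree b b' g g) //; apply: ord_in zg.
Qed.

(** Induction on [g]. Approximations are unique, so separation can decide each [x] by asking for
    some approximation below [x], and the pieces fit together. *)
Lemma greedy_below_ex g : ordinal g -> exists b, greedy_below b g.
Proof.
move: g; apply: (ord_ind (fun g => exists b, greedy_below b g)).
  by definable; apply: (defn_greedy_below (fun e => e 0) (fun e => e 1)); definable.
move=> g og IH.
have [|b Hb] := sep (fun x => x ∈ S /\ exists c, greedy_below c x /\ Q c x) g.
  by definable; apply: (defn_greedy_below (fun e => e 0) (fun e => e 1)); definable.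
exists b; split=> [x /Hb []//|x xg].
have [c C] := IH x xg; have ox := ord_in _ _ og xg.
have E : inter b x = c.
  apply: ext => z; rewrite in_inter; split.
    move=> [/Hb [zg [zS [d [Hd q]]]] zx].
    apply/(proj2 C _ zx); split=> //.
    suff -> : inter c z = d by [].
    apply: (greedy_below_uniq _ _ z) => //; first exact: ord_in zx.
    exact: greedy_below_inter C zx.
  move=> zc; have zx := proj1 C _ zc; split=> //.
  have [zS q] := proj1 (proj2 C _ zx) zc.
  apply/Hb; split; first exact: ord_trans xg zx.
  by split=> //; exists (inter c z); split=> //; apply: greedy_below_inter C zx.
rewrite E Hb; split.
  move=> [_ [xS [d [Hd q]]]]; split=> //.
  by rewrite (greedy_below_uniq c d x).
by move=> [xS q]; split=> //; split=> //; exists c.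
Qed.

Definition greedy : M :=
  setof (fun x => exists b, greedy_below b S /\ x ∈ b).

Lemma greedy_spec : greedy_below greedy S.
Proof.
have [b B] := greedy_below_ex S oS.
suff -> : greedy = b by [].
have K z : (exists b, greedy_below b S /\ z ∈ b) <-> z ∈ b.
  split=> [[b' [B' zb]]|zb]; last by exists b.
  by rewrite (greedy_below_uniq b b' S).
by apply: ext => z; rewrite in_setof //; exists b => t; apply: iff_sym.
Qed.

(** The fixed-point equation replaces Zorn's lemma: when [Q] forbids conflicts with the points
    already taken, each point otherwise eligible is in the set or conflicts with an earlier
    member. *)
Lemma in_greedy x : x ∈ greedy <-> x ∈ S /\ Q (inter greedy x) x.
Proof.
have [S1 H] := greedy_spec; split=> [h|[xS q]].
  by apply/(H _ (S1 _ h)).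
by apply/H.
Qed.

End Greedy.

(** * Codes below [k] *)

Section Main.
Variables (k kp J : M).
Hypotheses (ik : infinite_cardinal k)
  (Hkp : forall a, a ∈ kp <-> ordinal a /\ card_le a k)
  (okp : ordinal kp)
  (Nkp : ~ card_le kp k) (HJ : injection J (prod k k) k).

Let ck : cardinal k := proj1 ik.
Let ok : ordinal k := proj1 ck.

(** The successor reserves 0 for the root of a tree; values stay in [k] because an infinite cardinal
    is a limit. *)
Definition code x y : M := adj (app J (pr x y)) (app J (pr x y)).

Lemma tdef_code (u v : (nat -> M) -> M) : tdef u -> tdef v -> tdef (fun e => code (u e) (v e)).
Proof. by apply: (tdef_fun2 code); rewrite /code; definable. Qed.

Lemma J_app x y : x ∈ k -> y ∈ k -> maps J (pr x y) (app J (pr x y)).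
Proof.
have [[F _] _] := HJ.
move=> xk yk; have [|z h] := fn_ex _ _ (pr x y) F; first by rewrite pr_in_prod.
by rewrite (app_maps _ _ _ _ F h).
Qed.

Lemma code_in x y : x ∈ k -> y ∈ k -> code x y ∈ k.
Proof.
move=> xk yk; apply: card_limit => //.
by have [[_ Fb] _] := HJ; apply: Fb (J_app _ _ xk yk).
Qed.

Lemma code_emp x y : code x y <> emp.
Proof. by move=> E; apply/(in_emp (app J (pr x y))); rewrite -E in_adj; right. Qed.

Lemma code_inj x y x' y' : x ∈ k -> y ∈ k -> x' ∈ k -> y' ∈ k ->
  code x y = code x' y' -> x = x' /\ y = y'.
Proof.
move=> xk yk xk' yk' /adj_inj E; have [_ Fi] := HJ.
apply: pr_inj; apply: Fi (J_app _ _ xk yk) _; rewrite E; exact: J_app.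
Qed.

Lemma k_emp : emp ∈ k.
Proof. exact: nat_in_card ik nat_emp. Qed.

Lemma kp_emp : emp ∈ kp.
Proof. by apply/Hkp; split; [exact: ord_emp|apply: card_le_subset => z /in_emp]. Qed.

Lemma kp_ord a : a ∈ kp -> ordinal a.
Proof. by move/Hkp => []. Qed.

Lemma no_cover (R : M -> M -> Prop) : defn (fun e => R (e 0) (e 1)) ->
  (forall a, a ∈ kp -> exists c, c ∈ k /\ R a c) ->
  (forall a a' c, a ∈ kp -> a' ∈ kp -> R a c -> R a' c -> a = a') -> False.
Proof. by move=> D E I; apply: Nkp; apply: (card_le_least R). Qed.

Lemma defn_nth : defn (fun e => nth (e 0) (e 1) (e 2)).
Proof. by rewrite /nth /index /has_type /iso /seg; definable. Qed.

(** * Coding the reachable nodes of a tree *)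

Section Tree.
Variables (Y r : M) (Ch : M -> M -> M -> Prop).
Hypotheses (rY : r ∈ Y) (D : defn (fun e => Ch (e 0) (e 1) (e 2)))
  (U : forall s i x x', Ch s i x -> Ch s i x' -> x = x').

(* [Ch s i x]: the node [x] is the [i]-th child of [s].  The least relation
   giving the root the code [0] and the [i]-th child of a node with code [y]
   the code [code y i] has a functional inverse, since the code determines
   [y], [i] and hence the node: there are at most [k] reachable nodes. *)
Definition tree_closed R : Prop := pr r emp ∈ R /\
  forall s y i x, pr s y ∈ R -> y ∈ k -> i ∈ k -> x ∈ Y -> Ch s i x ->
    pr x (code y i) ∈ R.

(** Confining the nodes to the set [Y] ensures that a closed set exists, namely [prod Y k], so this
    intersection is not vacuous. *)
Definition coded x y : Prop := forall R, tree_closed R -> pr x y ∈ R.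

Lemma defn_coded : defn (fun e => coded (e 0) (e 1)).
Proof.
rewrite /coded /tree_closed; definable.
by apply: (tdef_code (fun e => e 2) (fun e => e 1)); definable.
Qed.

Lemma coded_dom x y : coded x y -> x ∈ Y /\ y ∈ k.
Proof.
move=> H; rewrite -pr_in_prod; apply: H; split.
  by rewrite pr_in_prod; split=> //; apply: k_emp.
move=> s z i t /pr_in_prod [sY zk] _ ik' tY _; rewrite pr_in_prod; split=> //.
exact: code_in.
Qed.

Lemma coded_root : coded r emp.
Proof. by move=> R []. Qed.

Lemma coded_step s y i x : coded s y -> i ∈ k -> x ∈ Y -> Ch s i x -> coded x (code y i).
Proof.
move=> H ik' xY C R [R0 RS].
exact: RS _ _ _ _ (H _ (conj R0 RS)) (proj2 (coded_dom _ _ H)) ik' xY C.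
Qed.

(** The coded pairs that arise in one of these two ways already form a closed set, so by leastness
    they are all the coded pairs. *)
Lemma coded_inv x y : coded x y -> (x = r /\ y = emp) \/
  exists s z i, coded s z /\ i ∈ k /\ Ch s i x /\ y = code z i.
Proof.
move=> H; have dc := defn_coded.
have [|R HR] := sep (fun p => exists x y, p = pr x y /\ coded x y /\ ((x = r /\ y = emp) \/
  exists s z i, coded s z /\ i ∈ k /\ Ch s i x /\ y = code z i)) (prod Y k).
  by definable; apply: (tdef_code (fun e => e 1) (fun e => e 0)); definable.
have /H /HR [_ [x' [y' [/pr_inj [<- <-] []]]]] // : tree_closed R.
split.
  rewrite HR pr_in_prod; split; first by split=> //; apply: k_emp.
  by exists r, emp; split=> //; split; [exact: coded_root|left].
move=> s z i t /HR [_ [s' [z' [/pr_inj [<- <-] [h _]]]]] zk ik' tY C.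
have ct := coded_step _ _ _ _ h ik' tY C.
rewrite HR pr_in_prod; split; first exact: coded_dom.
exists t, (code z i); split=> //; split=> //; right; by exists s, z, i.
Qed.

(** The pairs whose code determines the node form a closed set: a code is 0 only at the root, and
    otherwise it yields the code of the parent and the child index, hence the parent by induction
    and then the child by [U]. *)
Lemma coded_inj x x' y : coded x y -> coded x' y -> x = x'.
Proof.
move=> H; move: x'; have dc := defn_coded.
have [|R HR] := sep (fun p => exists x y, p = pr x y /\ coded x y /\
  forall x', coded x' y -> x = x') (prod Y k); first by definable.
have /H /HR [_ [t [u [/pr_inj [<- <-] []]]]] // : tree_closed R.
split.
  rewrite HR pr_in_prod; split; first by split=> //; apply: k_emp.
  exists r, emp; split=> //; split; first exact: coded_root.
  by move=> x' /coded_inv [[-> //]|[s [z [i [_ [_ [_ E]]]]]]]; case: (code_emp z i).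
move=> s z i t /HR [_ [s2 [z2 [/pr_inj [<- <-] [h IH]]]]] zk ik' tY C.
have ct := coded_step _ _ _ _ h ik' tY C.
rewrite HR pr_in_prod; split; first exact: coded_dom.
exists t, (code z i); split=> //; split=> //.
move=> x' /coded_inv [[_ E]|[s' [z' [i' [h' [ik2 [C' E]]]]]]]; first by case: (code_emp z i).
have [|e1 e2] := code_inj _ _ _ _ zk ik' _ ik2 E; first by case: (coded_dom _ _ h').
subst z' i'; have e := IH _ h'; subst s'; exact: U C C'.
Qed.

End Tree.

Lemma defn_code : defn (fun e => e 0 = code (e 1) (e 2)).
Proof. by rewrite /code; definable. Qed.

(** The counting step where choice would normally enter: since every [F d] is listed by the same
    definable rule, a point is coded by a code of some [d] together with its position in [F d]. *)
Lemma no_small_cover (F : M -> M) (C : M -> M -> Prop) :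
  defn (fun e => e 0 = F (e 1)) -> defn (fun e => C (e 0) (e 1)) ->
  (forall d c, C d c -> c ∈ k) ->
  (forall d d' c, C d c -> C d' c -> d = d') ->
  (forall d c, C d c -> subset (F d) kp /\ ~ big k (F d)) ->
  (forall a, a ∈ kp -> exists d c, C d c /\ a ∈ F d) -> False.
Proof.
move=> DF DC Ck Ci Fs Cov; have dn := defn_nth; have dc := defn_code.
have Fo d c : C d c -> forall x, x ∈ F d -> ordinal x.
  by move=> /Fs [S _] x /S; apply: kp_ord.
apply: (no_cover (fun a z => exists d c i,
  C d c /\ i ∈ k /\ nth (F d) a i /\ z = code c i)); first by definable.
- move=> a /Cov [d [c [h aF]]]; have [i hi] := nth_ex _ _ (Fo _ _ h) aF.
  have ik' := small_nth _ _ _ _ ok (Fo _ _ h) (proj2 (Fs _ _ h)) hi.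
  exists (code c i); split; first by apply: code_in => //; apply: Ck h.
  by exists d, c, i.
- move=> a a' z _ _ [d [c [i [h [ik1 [n ->]]]]]] [d' [c' [i' [h' [ik2 [n' E]]]]]].
  have [e1 e2] := code_inj _ _ _ _ (Ck _ _ h) ik1 (Ck _ _ h') ik2 E.
  subst c' i'; have e := Ci _ _ _ h h'; subst d'.
  exact: nth_inj (Fo _ _ h) n n'.
Qed.

(** * Fibres of functions: (1) and (3) *)

Lemma pigeonhole : arrow1 kp k k.
Proof.
move=> f [F Fb]; apply: NNPP => N.
pose fib c := setof (fun x => x ∈ kp /\ maps f x c).
have in_fib c x : x ∈ fib c <-> x ∈ kp /\ maps f x c.
  by rewrite in_setof //; apply: (sep (fun x => maps f x c)); definable.
apply: (no_small_cover fib (fun d c => d ∈ k /\ d = c)).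
- by apply: (tdef_setof (fun e x => x ∈ kp /\ maps f x (e 0))); definable.
- by definable.
- by move=> d c [h <-].
- by move=> d d' c [_ ->] [_ ->].
- move=> c _ [_ _]; split=> [x /in_fib []//|[h [S t]]].
  apply: N; exists h; split; first by move=> x /S /in_fib [].
  split; first exact: card_eq_sym (order_type_card _ _ t).
  by exists c => x /S /in_fib [].
- move=> a ap; have [c h] := fn_ex _ _ _ F ap.
  exists c, c; split; last by apply/in_fib.
  by split=> //; apply: Fb h.
Qed.

Lemma regressive_succ : regressive_property kp k.
Proof.
move=> f [F Fb] Rg; apply: NNPP => N.
pose fib c := setof (fun x => x ∈ kp /\ x <> emp /\ maps f x c).
have in_fib c x : x ∈ fib c <-> x ∈ kp /\ x <> emp /\ maps f x c.
  by rewrite in_setof //; apply: (sep (fun x => x <> emp /\ maps f x c)); definable.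
have fib_ord c x : x ∈ fib c -> ordinal x by move=> /in_fib [/kp_ord].
have small c : c ∈ kp -> ~ big k (fib c).
  move=> cp /big_card h; apply: N; exists c; split=> //.
  have [|r Hr] := sep (fun x => maps f x c) kp; first by definable.
  exists r; split.
    by move=> x; rewrite Hr; split=> [[]|h'] //; split=> //; apply: fn_dom h'.
  apply: card_le_trans h _; apply: card_le_subset => x /in_fib [xp [_ h']].
  by apply/Hr.
have dn := defn_nth.
pose Ch s i x := nth (fib s) x i.
have D : defn (fun e => Ch (e 0) (e 1) (e 2)) by rewrite /Ch /fib; definable.
have U s i x x' : Ch s i x -> Ch s i x' -> x = x' by apply: nth_inj; apply: fib_ord.
apply: (no_cover (coded kp emp Ch)).
- exact: defn_coded.
- move=> a ap; move: (a) (kp_ord a ap) (ap).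
  have dc := defn_coded kp emp Ch D.
  apply: (ord_ind (fun a => a ∈ kp -> exists c, c ∈ k /\ coded kp emp Ch a c)); first by definable.
  (* Iterating [f] descends from [a] to 0, so the value of [f] at [a] is a parent already coded by
     induction. *)
  move=> {ap} {}a oa IH ap.
  have [->|na] := classic (a = emp).
    by exists emp; split; [apply: k_emp|apply: coded_root].
  have [b h] := fn_ex _ _ _ F ap; have bp := Fb _ _ h.
  have [|c [ck' hc]] := IH b _ bp; first by apply: (Rg a b) => //; apply/nonemptyE.
  have af : a ∈ fib b by apply/in_fib.
  have [i hi] := nth_ex _ _ (fib_ord b) af.
  have ik' := small_nth _ _ _ _ ok (fib_ord b) (small _ bp) hi.
  exists (code c i); split; first exact: code_in.
  exact: (coded_step _ _ _ kp_emp _ _ _ _ hc).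
- by move=> a a' c _ _; apply: (coded_inj kp emp Ch kp_emp D U).
Qed.

(** * Trees of finite sequences of ordinals: (2) *)

Lemma seq_length_uniq s n n' : ordinal_seq s n -> ordinal_seq s n' -> n = n'.
Proof.
have half m m' : ordinal_seq s m -> ordinal_seq s m' -> subset m m'.
  move=> [_ [F _]] [_ [F' _]] z zm; have [y h] := fn_ex _ _ _ F zm; exact: fn_dom h.
by move=> h h'; apply: ext => z; split; apply: half.
Qed.

Lemma snoc_uniq s a t t' : is_snoc s a t -> is_snoc s a t' -> t = t'.
Proof.
move=> [n [h H]] [n' [h' H']]; have e := seq_length_uniq _ _ _ h h'; subst n'.
by apply: ext => p; rewrite H H'.
Qed.

Lemma seq_emp s : ordinal_seq s emp -> s = emp.
Proof.
move=> [_ [[F _] _]]; apply: ext => p; rewrite in_emp; split=> // /F.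
by move=> [x [y [/in_emp]]].
Qed.

Lemma emp_seq : ordinal_seq emp emp.
Proof.
split; first exact: nat_emp.
split; first by split=> [p /in_emp|x /in_emp].
by move=> i x /mapsE /in_emp.
Qed.

Lemma seq_snoc t m : ordinal_seq t (adj m m) ->
  exists s a, ordinal_seq s m /\ ordinal a /\ subset s t /\ is_snoc s a t.
Proof.
move=> [nm [F O]]; have om : m ∈ adj m m by rewrite in_adj; right.
have [|s Hs] := sep (fun p => exists i x, i ∈ m /\ p = pr i x) t; first by definable.
have K i x : maps s i x <-> i ∈ m /\ maps t i x.
  rewrite !mapsE Hs; split=> [[h [i' [x' [im /pr_inj [e _]]]]]|[im h]].
    by subst i'.
  by split=> //; exists i, x.
have [a ha] := fn_ex _ _ _ F om.
have qs : ordinal_seq s m.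
  split; first exact: nat_in om.
  split; last by move=> i x /K [_]; apply: O.
  split; first by move=> p /Hs [_ [i [x [im ->]]]]; exists i, x; rewrite is_pairE.
  move=> i im; have [|x h] := fn_ex _ _ i F; first by rewrite in_adj; left.
  by exists x; split; [apply/K|move=> y /K [_]; apply: fn_uniq F h].
exists s, a; split=> //; split; first exact: O ha.
split; first by move=> p /Hs [].
exists m; split=> // p; rewrite is_pairE; split; last first.
  by case=> [/Hs []//|->]; apply/mapsE.
move=> pt; have [i [x [/in_adj im /is_pairE e]]] := proj1 F _ pt; subst p.
case: im => [im|e]; first by left; apply/Hs; split=> //; exists i, x.
by right; subst i; rewrite (fn_uniq _ _ _ _ _ F ha (proj2 (mapsE _ _ _) pt)).
Qed.

Lemma tree_bound_self : tree_bound k k.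
Proof.
move=> T [T1 T2] Hc.
have [Te|/nonemptyE [t0 t0T]] := classic (T = emp).
  by rewrite Te; apply: card_le_subset => z /in_emp.
have eT : emp ∈ T.
  by apply: (T2 t0) => //; [exists emp; apply: emp_seq|move=> z /in_emp].
pose ch s := setof (fun a => ordinal a /\ exists t, is_snoc s a t /\ t ∈ T).
have Hch s : s ∈ T -> forall a, a ∈ ch s <-> ordinal a /\ exists t, is_snoc s a t /\ t ∈ T.
  by move=> sT; apply: in_setof; have [x [h _]] := Hc _ sT; exists x.
have ch_ord s : s ∈ T -> forall a, a ∈ ch s -> ordinal a by move=> sT a /(Hch _ sT) [].
have small s : s ∈ T -> ~ big k (ch s).
  move=> sT; have [x [h [xk nxk]]] := Hc _ sT.
  have -> : ch s = x by apply: ext => a; rewrite Hch // h.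
  by move=> /big_card kx; apply/nxk/card_le_antisym.
have dn := defn_nth.
(* The clause [s ∈ T] restricts to nodes where [Hc] guarantees that the children form a set, so that
   [ch s] is not a junk value. *)
pose Ch s i t := s ∈ T /\ exists a, nth (ch s) a i /\ is_snoc s a t.
have D : defn (fun e => Ch (e 0) (e 1) (e 2)).
  by rewrite /Ch /ch /is_snoc /ordinal_seq; definable.
have U s i t t' : Ch s i t -> Ch s i t' -> t = t'.
  move=> [sT [a [n h]]] [_ [a' [n' h']]].
  have e := nth_inj _ _ _ _ (ch_ord _ sT) n n'; subst a'; exact: snoc_uniq h h'.
have dc := defn_coded T emp Ch D.
have cov n : natural n -> forall t, t ∈ T -> ordinal_seq t n ->
    exists c, c ∈ k /\ coded T emp Ch t c.
  move: n; apply: (nat_ind' (fun n => forall t, t ∈ T -> ordinal_seq t n ->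
    exists c, c ∈ k /\ coded T emp Ch t c)); first by rewrite /ordinal_seq; definable.
    move=> t tT /seq_emp ->; exists emp; split; [exact: k_emp|exact: coded_root].
  move=> m nm IH t tT /seq_snoc [s [a [qs [oa [S h]]]]].
  have sT : s ∈ T by apply: (T2 t) => //; exists m.
  have [c [ck' hc]] := IH s sT qs.
  have ac : a ∈ ch s by apply/(Hch _ sT); split=> //; exists t.
  have [i hi] := nth_ex _ _ (ch_ord _ sT) ac.
  have ik' := small_nth _ _ _ _ ok (ch_ord _ sT) (small _ sT) hi.
  exists (code c i); split; first exact: code_in.
  by apply: (coded_step _ _ _ eT _ _ _ _ hc) => //; split=> //; exists a.
apply: (card_le_least (coded T emp Ch)) => //.
- by move=> t tT; have [n qt] := T1 _ tT; apply: (cov n) => //; case: qt.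
- by move=> t t' c _ _; apply: (coded_inj T emp Ch eT D U).
Qed.

(** * Delta-systems: (4) *)

Definition diff a b : M := setof (fun z => z ∈ a /\ ~ z ∈ b).

Lemma in_diff a b z : z ∈ diff a b <-> z ∈ a /\ ~ z ∈ b.
Proof. by rewrite in_setof //; apply: (sep (fun z => ~ z ∈ b)); definable. Qed.

Lemma delta_succ : arrow_delta kp k.
Proof.
move=> A HA /card_eq_sym [e [[[G Gb] Gi] Gs]]; apply: NNPP => N.
(* [B d]: a maximal Delta-system with kernel [d], as a set of indices. *)
pose B0 d := fun b x => subset d (app e x) /\
  forall y, y ∈ b -> forall z, z ∈ app e x -> z ∈ app e y -> z ∈ d.
have DB d : defn (fun v => B0 d (v 0) (v 1)) by rewrite /B0; definable.
have Ae x : x ∈ kp -> maps e x (app e x).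
  by move=> xp; have [y h] := fn_ex _ _ _ G xp; rewrite (app_maps _ _ _ _ G h).
have AA x : x ∈ kp -> finite (app e x) /\ forall z, z ∈ app e x -> ordinal z.
  by move=> /Ae /Gb /HA.
pose B d := greedy kp (B0 d).
have inB d x : x ∈ B d <-> x ∈ kp /\ B0 d (inter (B d) x) x := in_greedy _ _ okp (DB d) x.
have Bkp d : subset (B d) kp by move=> x /inB [].
have B_ord d x : x ∈ B d -> ordinal x by move=> /Bkp /kp_ord.
have ker d x y z : x ∈ B d -> y ∈ B d -> x <> y -> z ∈ app e x -> z ∈ app e y -> z ∈ d.
  move=> xB yB ne zx zy; have /inB [xp [_ hx]] := xB; have /inB [yp [_ hy]] := yB.
  case: (ord_cmp x y) => [||xy|[//|yx]]; [exact: kp_ord|exact: kp_ord| |].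
  - by apply: (hy x) => //; rewrite in_inter.
  - by apply: (hx y) => //; rewrite in_inter.
have small d : ~ big k (B d).
  move=> [h [S t]]; apply: N.
  have [|C HC] := sep (fun a => exists x, x ∈ h /\ maps e x a) A; first by definable.
  exists C; split; first by move=> a /HC [].
  split.
    exists d => a b /HC [aA [x [xh hx]]] /HC [bA [y [yh hy]]] ab z.
    have ex := app_maps _ _ _ _ G hx; have ey := app_maps _ _ _ _ G hy.
    have ne : x <> y by move=> E; subst y; apply: ab; rewrite -ex -ey.
    rewrite -ex -ey; split=> [zd|[zx zy]]; last by apply: (ker d x y) => //; apply: S.
    have /inB [_ [Sx _]] := S _ xh; have /inB [_ [Sy _]] := S _ yh.
    by split; [apply: Sx|apply: Sy].
  apply: card_eq_sym; apply: card_eq_trans (order_type_card _ _ t) _.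
  apply: (card_eq_intro (fun x a => maps e x a)); first by definable.
  - move=> x xh; have hx := Ae _ (Bkp _ _ (S _ xh)); exists (app e x); split=> //.
    by apply/HC; split; [apply: Gb hx|exists x].
  - by move=> x y y' _; apply: fn_uniq G.
  - by move=> x x' y _ _; apply: Gi.
  - by move=> a /HC [_ [x [xh hx]]]; exists x.
have dn := defn_nth; have dcd := defn_code.
have dB : defn (fun v => v 0 = B (v 1)).
  by rewrite /B /greedy /greedy_below /B0; definable.
(* A child index packs two positions: that of the member [app e x] in the system, and that of the
   added point [y] in this member. *)
pose Ch d i t := exists j m x y, i = code j m /\ j ∈ k /\ m ∈ k /\
  nth (B d) x j /\ nth (app e x) y m /\ t = adj d y.
have D : defn (fun v => Ch (v 0) (v 1) (v 2)) by rewrite /Ch; definable.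
have U d i t t' : Ch d i t -> Ch d i t' -> t = t'.
  move=> [j [m [x [y [-> [jk [mk [nx [ny ->]]]]]]]]].
  move=> [j' [m' [x' [y' [E [jk' [mk' [nx' [ny' ->]]]]]]]]].
  have [e1 e2] := code_inj _ _ _ _ jk mk jk' mk' E; subst j' m'.
  have e1 := nth_inj _ _ _ _ (B_ord d) nx nx'; subst x'.
  have xp := Bkp _ _ (proj1 nx).
  by rewrite (nth_inj _ _ _ _ (proj2 (AA _ xp)) ny ny').
have rY : emp ∈ pow (un A) by apply/in_pow => z /in_emp.
set C := coded (pow (un A)) emp Ch.
have dC : defn (fun v => C (v 0) (v 1)) := defn_coded _ _ _ D.
(* Induction on the number [n] of points of [app e a] outside the node [d]; every extension of [d]
   inside [app e a] lowers it by one. *)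
have cov n : natural n -> forall a d c, a ∈ kp -> C d c -> subset d (app e a) ->
    card_eq (diff (app e a) d) n -> exists d' c', C d' c' /\ a ∈ B d'.
  move: n; apply: (nat_ind' (fun n => forall a d c, a ∈ kp -> C d c -> subset d (app e a) ->
    card_eq (diff (app e a) d) n -> exists d' c', C d' c' /\ a ∈ B d')).
    by rewrite /diff; definable.
  (* Here [app e a] equals [d], so whatever it shares with another member lies in the kernel and [a]
     is never rejected. *)
  - move=> a d c ap hc S /card_eq_emp E; exists d, c; split=> //.
    apply/inB; split=> //; split=> // y _ z za _; apply: NNPP => zd.
    by apply/(in_emp z); rewrite -E in_diff.
  move=> n nn IH a d c ap hc S hn.
  have [aB|aB] := classic (a ∈ B d); first by exists d, c.
  (* As [d] is contained in [app e a], a rejection can only come from an earlier member sharing a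
     point [z] outside [d]; adding [z] gives a child of [d] still inside [app e a]. *)
  have [x [z [xB [xa [za [zx zd]]]]]] : exists x z,
      x ∈ B d /\ x ∈ a /\ z ∈ app e a /\ z ∈ app e x /\ ~ z ∈ d.
    apply: NNPP => N'; apply: aB; apply/inB; split=> //; split=> //.
    move=> x /in_inter [xB xa] z za zx; apply: NNPP => zd; apply: N'.
    by exists x, z.
  have xp := Bkp _ _ xB.
  have [j hj] := nth_ex _ _ (B_ord d) xB.
  have [m hm] := nth_ex _ _ (proj2 (AA _ xp)) zx.
  have jk := small_nth _ _ _ _ ok (B_ord d) (small d) hj.
  have mk : m ∈ k.
    apply: small_nth (proj2 (AA _ xp)) _ hm => //.
    by move=> /big_card; apply: finite_not_ge (proj1 (AA _ xp)).
  have [dY _] := coded_dom _ _ _ rY _ _ hc.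
  apply: (IH a (adj d z) (code c (code j m))) => //.
  - apply: (coded_step _ _ _ rY d) => //; first exact: code_in.
      apply/in_pow => t /in_adj [|->]; first by move/in_pow: dY; apply.
      by apply/in_un; exists (app e x); split=> //; apply: Gb (Ae _ xp).
    by exists j, m, x, z.
  - by move=> t /in_adj [/S|->].
  - suff -> : diff (app e a) (adj d z) = del (diff (app e a) d) z.
      by apply: card_del => //; rewrite in_diff.
    by apply: ext => t; rewrite in_del !in_diff in_adj; tauto.
apply: (no_small_cover B C) => //.
- by move=> d c /(coded_dom _ _ _ rY) [].
- by move=> d d' c; apply: (coded_inj _ _ _ rY D U).
- move=> a ap; have [fa _] := AA _ ap.
  have [n [nn hn]] : finite (diff (app e a) emp).
    suff -> : diff (app e a) emp = app e a by [].
    by apply: ext => z; rewrite in_diff in_emp; tauto.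
  apply: (cov n nn a emp emp) => //; first exact: coded_root.
  by move=> z /in_emp.
Qed.

(** * Homogeneous sets of type [k] or [omega + 1]: (5) *)

Lemma order_type_adj h l x : order_type h l -> (forall z, z ∈ h -> z ∈ x) ->
  order_type (adj h x) (adj l l).
Proof.
move=> [g [[[[G Gb] Gi] Gs] Go]] H.
have lt i y : maps g i y -> i ∈ l by apply: fn_dom.
have hx i y : maps g i y -> y ∈ x by move=> /Gb /H.
have [|i|i y y' _ [h1|[h1 ->]] [h2|[h2 ->]]|f [F K]] // :=
  lam (fun i y => maps g i y \/ (i = l /\ y = x)) (adj l l); first by definable.
- move=> /in_adj [/(fn_ex _ _ _ G) [y hy]|->]; [by exists y; left|by exists x; right].
- exact: (fn_uniq _ _ _ _ _ G h1 h2).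
- by subst i; case: (mem_irrefl l); apply: lt h1.
- by subst i; case: (mem_irrefl l); apply: lt h2.
exists f; split; first split; first split; first split=> //.
- move=> i y /K [_ [/Gb h1|[_ ->]]]; rewrite in_adj; tauto.
- move=> i i' y /K [_ [h1|[-> e1]]] /K [_ [h2|[-> e2]]] //; first exact: (Gi _ _ _ h1 h2).
  + by subst y; case: (mem_irrefl x); apply: hx h1.
  + by subst y; case: (mem_irrefl x); apply: hx h2.
- move=> y /in_adj [/Gs [i h1]|->]; last by exists l; rewrite K in_adj; tauto.
  by exists i; rewrite K in_adj; split; left=> //; apply: lt h1.
- move=> i j y z /K [_ [h1|[-> ->]]] /K [_ [h2|[-> ->]]].
  + exact: Go h1 h2.
  + by split=> _; [apply: hx h1|apply: lt h1].
  + by split=> h3; [case: (mem_asym _ _ h3); apply: lt h2|case: (mem_asym _ _ h3); apply: hx h2].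
  + by split=> /mem_irrefl.
Qed.

Lemma omega1_succ : arrow_omega1 kp k.
Proof.
move=> zero one two w w1 q /emptyE -> /is_succE -> /is_succE -> /is_omegaE -> /is_succE -> Hq
  f [F Fb]; clear zero one two w w1.
set one := adj emp emp.
apply: NNPP => N.
(* From here [f] is read as a graph on [kp], with colour 1 as the edges. *)
pose E x y := maps f (upr x y) one.
have dE : defn (fun v => E (v 0) (v 1)) by rewrite /E; definable.
have Esym x y : E x y -> E y x.
  by rewrite /E; suff -> : upr x y = upr y x by []; apply: ext => z; rewrite !in_upr; tauto.
have E0 x y : x ∈ kp -> y ∈ kp -> x <> y -> ~ E x y -> maps f (upr x y) emp.
  move=> xp yp ne nE.
  have [|z h] := fn_ex _ _ (upr x y) F.
    by apply/Hq; exists x, y; rewrite is_uprE.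
  have := Fb _ _ h; rewrite in_adj => -[|e]; last by subst z.
  by rewrite in_adj in_emp => -[//|e]; subst z.
have hom h c : (forall x y, x ∈ h -> y ∈ h -> x ∈ y -> maps f (upr x y) c) ->
    (forall x, x ∈ h -> ordinal x) -> homogeneous f h c.
  move=> H O q' Hq' p /Hq' [x [y [xh [yh [ne /is_uprE ->]]]]].
  case: (ord_cmp x y) => [||xy|[//|yx]]; [exact: O|exact: O|exact: H|].
  suff -> : upr x y = upr y x by apply: H.
  by apply: ext => z; rewrite !in_upr; tauto.
(* [H d]: a maximal [0]-homogeneous subset of the [x] above [d] for which
   [d ∪ {x}] extends [d] by a point joined to all of [d] in colour [1]. *)
pose H0 d := fun b x => (forall y, y ∈ d -> y ∈ x /\ E y x) /\ forall y, y ∈ b -> ~ E y x.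
have DH d : defn (fun v => H0 d (v 0) (v 1)) by rewrite /H0; definable.
pose H d := greedy kp (H0 d).
have inH d x : x ∈ H d <-> x ∈ kp /\ H0 d (inter (H d) x) x := in_greedy _ _ okp (DH d) x.
have Hkp' d : subset (H d) kp by move=> x /inH [].
have H_ord d x : x ∈ H d -> ordinal x by move=> /Hkp' /kp_ord.
have small d : ~ big k (H d).
  move=> [h [S t]]; apply: N; left; exists h.
  split; first by move=> x /S /Hkp'.
  split=> //; apply: hom; last by move=> x /S /H_ord.
  move=> x y /S xH /S yH xy; apply: E0; [exact: Hkp' xH|exact: Hkp' yH| |].
    by move=> e; subst y; apply: mem_irrefl xy.
  by have /inH [_ [_ hy]] := yH; apply: hy; rewrite in_inter.
have dH : defn (fun v => v 0 = H (v 1)).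
  by rewrite /H /greedy /greedy_below /H0; definable.
(* [K a ∪ {a}] is [1]-homogeneous and [a ∈ H (K a)]; if [K a] were infinite,
   its first [omega] elements and [a] would have order type [omega + 1]. *)
pose K a := greedy a (fun b x => E x a /\ x ∈ H b).
have inK a x : a ∈ kp -> x ∈ K a <-> x ∈ a /\ E x a /\ x ∈ H (inter (K a) x).
  by move=> ap; apply: (in_greedy a (fun b x => E x a /\ x ∈ H b)); [exact: kp_ord|definable].
have K_ord a x : a ∈ kp -> x ∈ K a -> ordinal x.
  by move=> ap /(inK _ _ ap) [xa _]; apply: ord_in xa; apply: kp_ord.
have KE a x y : a ∈ kp -> x ∈ K a -> y ∈ K a -> x ∈ y -> E x y.
  move=> ap xK /(inK _ _ ap) [_ [_ /inH [_ [h _]]]] xy.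
  by have [|] // := h x; first by rewrite in_inter.
have Kfin a : a ∈ kp -> exists l, natural l /\ has_type mem (K a) l.
  move=> ap; have KO x : x ∈ K a -> ordinal x by apply: K_ord.
  have [l tl] := ords_type (K a) KO; exists l; split=> //; apply/in_omega.
  case: (ord_le omega l) => //; [exact: ord_omega|exact: (proj1 tl)|move=> wl].
  have [h [S t]] := type_shrink _ _ _ KO tl ord_omega wl.
  have hK x : x ∈ h -> x ∈ a /\ E x a by move=> /S /(inK _ _ ap) [? []].
  case: N; right; exists (adj h a).
  have Sk : subset (adj h a) kp.
    by move=> x /in_adj [/hK [xa _]|->] //; apply: ord_trans xa.
  split=> //; split; first by apply: order_type_adj => // x /hK [].
  apply: hom; last by move=> x /Sk /kp_ord.
  move=> x y /in_adj [xh|->] /in_adj [yh|->] xy.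
  - by apply: (KE a) => //; apply: S.
  - by case: (hK _ xh).
  - by case: (mem_asym _ _ xy); case: (hK _ yh).
  - by case: (mem_irrefl a).
have dn := defn_nth.
pose Ch d i t := exists x, nth (H d) x i /\ t = adj d x.
have D : defn (fun v => Ch (v 0) (v 1) (v 2)) by rewrite /Ch; definable.
have U d i t t' : Ch d i t -> Ch d i t' -> t = t'.
  by move=> [x [h ->]] [x' [h' ->]]; rewrite (nth_inj _ _ _ _ (H_ord d) h h').
have rY : emp ∈ pow kp by apply/in_pow => z /in_emp.
set C := coded (pow kp) emp Ch.
have dC : defn (fun v => C (v 0) (v 1)) := defn_coded _ _ _ D.
(* Finite initial segments of [K a] are nodes, by induction on their length: the last point [x] lies
   in [H] of the points of [K a] before it. *)
have cov a : a ∈ kp -> forall j, natural j -> forall b, initial (K a) mem b ->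
    has_type mem b j -> exists c, C b c.
  move=> ap; have W := wo_ords _ (fun x => K_ord a x ap); have dm := defn_memr.
  apply: (nat_ind' (fun j => forall b, initial (K a) mem b ->
    has_type mem b j -> exists c, C b c)); first by rewrite /initial /has_type /iso; definable.
    move=> b _ /type_card_eq /card_eq_sym /card_eq_emp ->.
    by exists emp; apply: coded_root.
  move=> m nm IH b Ib tb.
  have [|x [xb hx]] := type_seg _ _ dm _ _ m Ib tb; first by rewrite in_adj; right.
  have [xK tx] := hx.
  have [c hc] := IH _ (seg_initial _ _ dm W _ xK) tx.
  have Es : seg (K a) mem x = inter (K a) x.
    by apply: ext => z; rewrite (in_seg _ mem dm).
  have [xa [_ xH]] := proj1 (inK _ _ ap) xK.
  have [i hi] := nth_ex _ _ (H_ord _) xH.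
  have ik' := small_nth _ _ _ _ ok (H_ord _) (small _) hi.
  (* [b] has type [m + 1] and [x] has index [m], so [x] is the largest point of [b]. *)
  have Eb : b = adj (seg (K a) mem x) x.
    apply: ext => z; rewrite in_adj (in_seg _ mem dm); split; last first.
      by case=> [[zK zx]|->] //; apply: (proj2 Ib) zx.
    move=> zb; have zK := proj1 Ib _ zb; have [t ht] := index_ex _ _ dm W _ zK.
    have := type_index _ _ dm W _ _ _ _ Ib tb zb ht; rewrite in_adj.
    case: (ord_cmp z x) => [||zx|[->|xz]]; [exact: K_ord zK|exact: K_ord xK|by left|by right|].
    have mt := index_lt _ _ dm W _ _ _ _ hx ht xz.
    by case=> [/mem_asym//|e]; subst t; case: (mem_irrefl m).
  exists (code c i); rewrite Eb; apply: (coded_step _ _ _ rY _ _ _ _ hc) => //.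
    apply/in_pow; rewrite -Eb => z /(proj1 Ib) /(inK _ _ ap) [za _].
    exact: ord_trans za.
  by exists x; rewrite {1}Es.
apply: (no_small_cover H C) => //.
- by move=> d c /(coded_dom _ _ _ rY) [].
- by move=> d d' c; apply: (coded_inj _ _ _ rY D U).
- move=> a ap; have [l [nl tl]] := Kfin a ap.
  have [c hc] := cov a ap l nl (K a) (initial_X _ _) tl.
  exists (K a), c; split=> //; apply/inH; split=> //; split.
    by move=> y /(inK _ _ ap) [ya [h _]].
  (* A member [y] of [H (K a)] lies above all of [K a]. If it lay below [a] and were joined to [a],
     it would satisfy the condition for entering [K a], and so lie above itself. *)
  move=> y /in_inter [yH ya] Eya.
  have [_ [hy _]] := proj1 (inH _ _) yH.
  have yK : y ∈ K a.
    apply/inK => //; split=> //; split=> //.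
    suff -> : inter (K a) y = K a by [].
    by apply: ext => z; rewrite in_inter; split=> [[]|zK] //; split=> //; case: (hy _ zK).
  by case: (mem_irrefl y); case: (hy _ yK).
Qed.

End Main.
End ZFTheory.

Theorem theorem2p3 (M : structure) (HZF : ZF M) (k : M) (hk : infinite_cardinal k) :
  exists kp : M, is_cardinal_succ k kp /\
    arrow1 kp k k /\
    tree_bound k k /\
    regressive_property kp k /\
    arrow_delta kp k /\
    arrow_omega1 kp k.
Proof.
have [kp Hkp] := hartogs M HZF k.
have [Sk Nk] := hartogs_succ M HZF k kp (proj1 hk) Hkp.
have okp := proj1 (proj1 Sk).
have [J HJ] := square_le M HZF k hk.
exists kp; split=> //; split; first exact: pigeonhole HJ.
split; first exact: tree_bound_self HJ.
split; first exact: regressive_succ HJ.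
split; first exact: delta_succ HJ.
exact: omega1_succ HJ.
Qed.
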